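(* Let $m\ge1$ and $k\ge1$ be integers, let $(t_i)_{i\in\mathbb Z}$ be a strictly increasing sequence of real numbers, let $(m_i)_{i\in\mathbb Z}$ be integers with $1\le m_i\le m$, and let $\mathcal W_m$ be the associated complex spline space. Let $E=\{x_i:1\le i\le K\}\subset[t_0,t_k]$ be a sequence consisting of distinct points. Then $E$ is a linear sampling sequence for $|\mathcal W_m|^2_{[t_0,t_k]}$ if and only if all of the following hold: \begin{align*} \# E &\ge 2m+1+\sum_{l=1}^{k-1}(m+m_l),\\ \#(E\cap[t_0,t_i)) &\ge \sum_{l=1}^{i}(m+m_l),\qquad 1\le i\le k,\\ \#(E\cap(t_i,t_k]) &\ge \sum_{l=i}^{k-1}(m+m_l),\qquad 0\le i\le k-1,\\ \#(E\cap(t_i,t_j)) &\ge \sum_{l=i}^{j}(m+m_l)-2m-1,\qquad 0\le i<j\le k. \end{align*}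
   Context: Empty sums are $0$; $\#$ denotes cardinality. Spline space. Let $m\ge1$, $(t_i)_{i\in\mathbb Z}$ real with $t_i<t_{i+1}$, and $(m_i)_{i\in\mathbb Z}$ integers with $1\le m_i\le m$. The B-spline of degree $m$ with knots $y_0\le\cdots\le y_{m+1}$ (repeated according to multiplicity) is $x\mapsto[y_0,\dots,y_{m+1}](\cdot-x)_+^m$, the divided difference in the variable $y$ of $(y-x)_+^m$ (the normalization by a positive constant is irrelevant). For $i\in\mathbb Z$ and $1\le l\le m_i$, $Q_{i,l}$ is the degree-$m$ B-spline with $m+2$ knots $(t_i,\dots,t_i,t_{i+1},\dots,t_{i+n})$, where $t_i$ appears $l$ times, $t_j$ appears $m_j$ times for $i+1\le j\le i+n-1$, and $t_{i+n}$ appears $m+2-(l+m_{i+1}+\cdots+m_{i+n-1})$ times; here $n\ge1$ is the unique integer for which this last number is between $1$ and $m_{i+n}$. Set $$\mathcal W_m=\Big\{\sum_{i\in\mathbb Z}\sum_{1\le l\le m_i}c_{i,l}Q_{i,l}:\ c_{i,l}\in\mathbb C\Big\}$$ (a locally finite sum). $|\mathcal W_m|^2_{[a,b]}$ denotes the set of restrictions to $[a,b]$ of the functions $|f|^2$, $f\in\mathcal W_m$. For a set $H$ of functions on $[a,b]$ (not necessarily a linear space), a finite sequence $E=\{x_n:1\le n\le N\}\subset[a,b]$ is a linear sampling sequence for $H$ if there exist functions $S_1,\dots,S_N$ on $[a,b]$ such that $h(x)=\sum_{n=1}^N h(x_n)S_n(x)$ for all $x\in[a,b]$ and all $h\in H$.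 *)

(* Defs.v *)
From HB Require Import structures.
From mathcomp Require Import all_boot all_order all_algebra.
From mathcomp Require Import zify.
From mathcomp Require Import all_classical all_reals all_analysis.
From mathcomp Require Export complex.

Set Implicit Arguments.
Unset Strict Implicit.
Unset Printing Implicit Defensive.

Import Order.TTheory GRing.Theory Num.Theory.
Import numFieldNormedType.Exports.

Local Open Scope classical_set_scope.
Local Open Scope ring_scope.
Local Open Scope complex_scope.

(* The divided difference [y 0, ..., y n] f for nondecreasing knots
   y 0 <= ... <= y n: when y 0 = y n all the knots coincide and the value is the
   Taylor coefficient of f (which is f (y 0) itself for n = 0). *)
Fixpoint divided_difference (R : realType) (f : R -> R) (n : nat)
    (y : nat -> R) : R :=
  if y 0%N == y n then (f^`(n))%classic (y 0%N) / n`!%:R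
  else if n is n'.+1 then
    (divided_difference f n' (fun i => y i.+1) - divided_difference f n' y)
      / (y n - y 0%N)
  else 0.

(* No knot has multiplicity larger than m below, so only the derivatives of
   order at most m - 1 of y |-> (y - x)_+^m are used, and these exist
   everywhere, y = x included. *)
Definition bspline (R : realType) (m : nat) (y : seq R) (x : R) : R :=
  divided_difference (fun z => Num.max (z - x) 0 ^+ m) m.+1 (nth 0 y).

Section Splines.
Variables (R : realType) (m : nat) (t : int -> R) (mu : int -> nat).

(* The multiplicity of t (i + n) as last knot of Q_{i,l}. The truncated
   subtraction is harmless: the value only matters when it is positive. *)
Definition last_mult (i : int) (l n : nat) : nat :=
  (m + 2 - (l + \sum_(1 <= j < n) mu (i + j%:Z)%R))%N.

Definition is_last_knot (i : int) (l n : nat) : Prop :=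
  (1 <= n)%N /\ (1 <= last_mult i l n <= mu (i + n%:Z)%R)%N.

Definition last_knot (i : int) (l : nat) : nat :=
  [get n | is_last_knot i l n].

Definition knots (i : int) (l : nat) : seq R :=
  let n := last_knot i l in
  nseq l (t i)
  ++ flatten [seq nseq (mu (i + j%:Z)) (t (i + j%:Z)) | j <- index_iota 1 n]
  ++ nseq (last_mult i l n) (t (i + n%:Z)).

Definition Q (i : int) (l : nat) : R -> R := bspline m (knots i l).

(* For each x only finitely many Q i l x are nonzero, so that the finitely
   supported sum over int is the locally finite sum, even if t is bounded. *)
Definition spline_space : set (R -> R[i]) :=
  [set f | exists c : int -> nat -> R[i], forall x,
     f x = \sum_(i \in [set: int])
             \sum_(1 <= l < (mu i).+1) c i l * (Q i l x)%:C].

End Splines.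

Definition squared_modulus_on (R : realType) (W : set (R -> R[i])) (a b : R) :
    set (R -> R[i]) :=
  [set patch (cst 0) `[a, b] (fun x => `|f x| ^+ 2) | f in W].

(* Functions on [a, b] are represented by functions on R of which only the
   values on [a, b] are used. *)
Definition linear_sampling (R : realType) (a b : R) (H : set (R -> R[i]))
    (N : nat) (E : N.-tuple R) : Prop :=
  exists S : 'I_N -> R -> R[i],
    forall h, H h -> forall x, x \in `[a, b]%R ->
      h x = \sum_(n < N) h (tnth E n) * S n x.

Definition num_points (R : realType) (N : nat) (E : N.-tuple R)
    (I : interval R) : nat := count (mem I) E.

Lemma last_knot_uniq (m : nat) (mu : int -> nat)
    (hmu : forall i, (1 <= mu i <= m)%N) (i : int) (l : nat)
    (hl : (1 <= l <= mu i)%N) : exists! n, is_last_knot m mu i l n.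
Proof.
pose s n := (\sum_(1 <= j < n) mu (i + j%:Z)%R)%N.
have s1 : s 1%N = 0%N by rewrite /s big_geq.
have sS n : (1 <= n)%N -> s n.+1 = (s n + mu (i + n%:Z)%R)%N.
  by move=> n1; rewrite /s big_nat_recr.
have s_ge n : (n <= s n.+1)%N.
  elim: n => // n IHn; rewrite sS//.
  by have := hmu (i + n.+1%:Z)%R; move: IHn; lia.
have s_mono p q : (1 <= p)%N -> (p <= q)%N -> (s p <= s q)%N.
  move=> p1; elim: q => [|q IHq] pq; first by lia.
  move: pq; rewrite leq_eqVlt => /predU1P[->//|]; rewrite ltnS => pq.
  by rewrite sS; [have := IHq pq; lia | lia].
have ex : exists n, (m + 2 <= l + s n.+1)%N.
  by exists (m + 2)%N; have := s_ge (m + 2)%N; lia.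
have hi := hmu i.
case: (ex_minnP ex) => n hn minn; exists n.
have n1 : (1 <= n)%N by case: n hn {minn} => //; rewrite s1; lia.
have hlt : (l + s n < m + 2)%N.
  rewrite ltnNge; apply/negP => h.
  by have := minn n.-1; rewrite prednK// => /(_ h); lia.
split.
  split=> //; rewrite /last_mult -/(s n).
  by move: hn; rewrite sS//; lia.
move=> p [p1]; rewrite /last_mult -/(s p) => hp.
have p2 : (m + 2 <= l + s p.+1)%N by rewrite sS//; lia.
have np := minn p p2.
apply/eqP; rewrite eqn_leq np /= leqNgt; apply/negP => lt_np.
have := s_mono n.+1 p isT lt_np; lia.
Qed.

(* Main.v *)
Require Import Defs.
From mathcomp Require Import all_boot all_order all_algebra.
From mathcomp Require Import zify ring lra.
From mathcomp Require Import all_classical all_reals all_analysis.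
From mathcomp Require Import polyrcf.

(** Linear sampling is a property of the linear span of the family, and on
    [t 0, t k] the span of the squared moduli is known. With f = u + i v, the
    square |f|^2 = u^2 + v^2 is a sum of squares of real splines, and
    polarization recovers all products u v. A product of two splines is a
    piecewise polynomial of degree 2m whose pieces agree at t l to the order
    m + 1 - mu l, and every such piecewise polynomial is a combination of
    products, because (x - t l)_+^q times a polynomial of degree m is a product
    of two splines whenever m - mu l < q <= m (ppspline_in_products). So E is a
    sampling sequence exactly when a smooth piecewise polynomial of degree 2m
    that vanishes on E vanishes on [t 0, t k], and the four inequalities are a
    Schoenberg-Whitney condition for this space, in which t l is a knot of
    multiplicity m + mu l.

    Necessity is linear algebra (sampling_count). A piecewise polynomial is
    determined by its jumps, and the jump at t l has m + mu l free coefficients.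
    If it is to vanish to the right of the last chosen knot, the jumps must add
    up to 0, which costs 2m + 1 equations; so if some interval contains too few
    points of E, there is a nonzero element supported there that vanishes on E.
    A free polynomial piece at an end of [t 0, t k] is a jump with all its 2m + 1
    coefficients free; this gives the four inequalities from one count.

    Sufficiency is a zero count (spline_zeros, counts_determine). On a maximal
    run of nonzero pieces, the number of sign changes in the sequence of
    derivatives of the piece at x cannot increase with x between two knots, and
    it decreases at each zero: this is the Budan-Fourier theorem. At a knot with
    multiplicity M only the last M derivatives may change, so that at most M sign
    changes are gained. Comparing the two ends of the run gives fewer zeros than
    the number of points that the inequalities guarantee. And
    once the elements of a finite-dimensional space are determined by their
    values on E, linear algebra gives the functions S_n (sampling_of_determined).

    It remains to see which functions the B-splines span. A divided difference is
    a combination of derivatives at the knots, in which the highest derivative at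
    the last knot has a nonzero coefficient (jet_difference_in, top_jet_in).
    Hence each B-spline is a combination of the functions (t j - x)_+^(m - s)
    with s < mu j, and conversely these functions are obtained one after the
    other from left to right; the process starts because those with j <= 0 vanish
    on [t 0, t k] (trunc_pow_real_spline). Those with j >= k are polynomials on
    [t 0, t k], and they span the polynomials of degree m by a Vandermonde
    argument (monomial_in). *)

Set Implicit Arguments.
Unset Strict Implicit.
Unset Printing Implicit Defensive.

Import Order.TTheory GRing.Theory Num.Theory.
Import numFieldNormedType.Exports.

Local Open Scope ring_scope.

(** * Sign variations and the zeros of a spline *)

Section SignVariations.
Variable R : rcfType.
Implicit Types (p q : {poly R}) (x y a b : R) (s : bool) (n r : nat).

(** The number of sign changes in [s; p x; p' x; ...; p^(n-1) x] when zeros are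
    dropped. This is the count just to the right of x, where a derivative that
    vanishes at x takes the sign of the next one. A sign is a boolean, true
    for positive; the initial sign [s] makes the recursion on [n] close. *)
Fixpoint var_right n s p x : nat :=
  if n is n'.+1 then
    if p.[x] == 0 then var_right n' s p^`() x
    else ((((0 < p.[x])%R) != s) + var_right n' (0 < p.[x])%R p^`() x)%N
  else 0%N.

(** The same count just to the left of x, where a derivative that vanishes at x
    has the sign opposite to the next one, so that each zero counts as a change.
    Zeros that come after the last nonzero derivative do not count, which is why
    the recursion stops at the zero polynomial. *)
Fixpoint var_left n s p x : nat :=
  if n is n'.+1 then
    if p == 0 then 0%N
    else if p.[x] == 0 then (var_left n' (~~ s) p^`() x).+1
    else ((((0 < p.[x])%R) != s) + var_left n' (0 < p.[x])%R p^`() x)%N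
  else 0%N.

(** Minimizing over the initial sign gives the number of sign changes of the
    sequence itself: the best initial sign is the first sign that occurs. *)
Definition min_var_right n p x :=
  minn (var_right n true p x) (var_right n false p x).

Definition min_var_left n p x :=
  minn (var_left n true p x) (var_left n false p x).

Lemma var_right_leq n s p x : (var_right n s p x <= n)%N.
Proof.
elim: n s p => //= n IHn s p; case: ifP => _.
  by rewrite (leq_trans (IHn _ _)).
by rewrite -add1n leq_add ?leq_b1.
Qed.

Lemma var_right_lipschitz n s1 s2 p x :
  (var_right n s1 p x <= (var_right n s2 p x).+1)%N.
Proof.
elim: n s1 s2 p => //= n IHn s1 s2 p; case: ifP => _ //.
by case: (0 < p.[x])%R s1 s2 => [] [] []; rewrite /=; lia.
Qed.

Lemma var_right_root n s p x : p.[x] = 0 ->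
  var_right n.+1 s p x = var_right n s p^`() x.
Proof. by move=> /= ->; rewrite eqxx. Qed.

Lemma var_left_root n s p x : p != 0 -> p.[x] = 0 ->
  var_left n.+1 s p x = (var_left n (~~ s) p^`() x).+1.
Proof. by move=> /= /negPf-> ->; rewrite eqxx. Qed.

Lemma var_left0 n s x : var_left n s 0 x = 0%N.
Proof. by case: n => //= n; rewrite eqxx. Qed.

Lemma dvdp_XsubC_exp_deriv p x r :
  (('X - x%:P) ^+ r.+1 %| p)%R -> (('X - x%:P) ^+ r %| p^`())%R.
Proof.
move=> /dvdpP[u ->]; rewrite derivM deriv_exp derivXsubC mul1r /=.
rewrite dvdp_add//.
  by rewrite exprS mulrA dvdp_mull.
by apply: dvdp_mull; rewrite -mulr_natl dvdp_mull.
Qed.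

Lemma dvdp_XsubC_exp_horner p x r :
  (('X - x%:P) ^+ r.+1 %| p)%R -> p.[x] = 0.
Proof.
by move=> /dvdpP[u ->]; rewrite exprS !hornerM hornerXsubC subrr mul0r mulr0.
Qed.

Lemma deriv_eq0_horner p x : p^`() = 0 -> p.[x] = 0 -> p = 0.
Proof.
move=> p'0 px0; apply/polyP => -[|i]; last first.
  have /eqP := congr1 (fun q : {poly R} => q`_i) p'0.
  by rewrite coef_deriv !coef0 mulrn_eq0 => /eqP.
have /size1_polyC pC : (size p <= 1)%N.
  apply/leq_sizeP => -[//|j] _.
  have /eqP := congr1 (fun q : {poly R} => q`_j) p'0.
  by rewrite coef_deriv !coef0 mulrn_eq0 => /eqP.
by move: px0; rewrite pC hornerC coefC eqxx coef0.
Qed.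

Lemma size_deriv_leq p n : (size p <= n.+1)%N -> (size p^`() <= n)%N.
Proof.
have [->|p0] := eqVneq p 0; first by rewrite deriv0 size_poly0.
by move=> pn; have := lt_size_deriv p0; lia.
Qed.

(** The first r derivatives of p and q agree at x, and each of the other n - r
    entries creates at most one sign change. *)
Lemma var_right_jump n r s p q x : (('X - x%:P) ^+ r %| q - p)%R ->
  (var_right n s q x <= var_left n s p x + (n - r))%N.
Proof.
elim: n r s p q => //= n IHn [|r] s p q qp.
  by rewrite subn0 (leq_trans (var_right_leq n.+1 s q x))// leq_addl.
have /IHn IH : (('X - x%:P) ^+ r %| q^`() - p^`())%R.
  by rewrite -derivB dvdp_XsubC_exp_deriv.
have /eqP : (q - p).[x] = 0 by apply: dvdp_XsubC_exp_horner qp.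
rewrite !hornerE subr_eq0 => /eqP ->; rewrite subSS.
have [p0|p0] := eqVneq p 0.
  by have := IH s; rewrite p0 horner0 eqxx deriv0 var_left0.
case: ifP => _; last by rewrite -addnA leq_add2l.
have := IH (~~ s); have := var_right_lipschitz n s (~~ s) q^`() x; lia.
Qed.

(** A zero of p at x costs one more sign change: p has opposite signs on the two
    sides of it relative to p', so the optimal initial signs on the two sides
    differ. For q = p this is the loss of a sign change in the Budan-Fourier
    theorem; in general it is the balance at a knot of a spline. *)
Lemma min_var_jump n r p q x : p != 0 ->
  (('X - x%:P) ^+ r.+1 %| q - p)%R ->
  ((p.[x] == 0%R) + min_var_right n.+1 q x
     <= min_var_left n.+1 p x + (n - r))%N.
Proof.
move=> p0 qp.
have jt := var_right_jump n.+1 true qp.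
have jf := var_right_jump n.+1 false qp.
have [px|px] := eqVneq p.[x] 0; last first.
  by rewrite add0n /min_var_right /min_var_left; move: jt jf; lia.
have /eqP : (q - p).[x] = 0 by apply: dvdp_XsubC_exp_horner qp.
rewrite !hornerE subr_eq0 px => /eqP qx.
have qp' : (('X - x%:P) ^+ r %| q^`() - p^`())%R.
  by rewrite -derivB dvdp_XsubC_exp_deriv.
have := var_right_jump n true qp'; have := var_right_jump n false qp'.
rewrite /min_var_right /min_var_left /= px qx eqxx (negPf p0) /=; lia.
Qed.

(** The r leading zeros are dropped, and the other n + 1 - r entries, preceded by
    the sign of the first of them, have at most n - r sign changes. *)
Lemma min_var_right_zeros n r p x : p != 0 -> (size p <= n.+1)%N ->
  (('X - x%:P) ^+ r %| p)%R -> (min_var_right n.+1 p x + r <= n)%N.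
Proof.
move=> p0 pn rp.
suff [s hs] : exists s, (var_right n.+1 s p x + r <= n)%N.
  by case: s hs => hs; apply: leq_trans hs; rewrite leq_add2r ?geq_minl ?geq_minr.
elim: n r p p0 pn rp => [|n IHn] r p p0 pn rp.
  have r0 : r = 0%N.
    by have := leq_trans (dvdp_leq p0 rp) pn; rewrite size_exp_XsubC ltnS leqn0 => /eqP.
  exists (0 < p.[x])%R; rewrite r0 addn0 /=.
  by case: ifP => //= _; case: (0 < p.[x])%R.
have [px|px] := eqVneq p.[x] 0; last first.
  case: r rp => [_|r /dvdp_XsubC_exp_horner/eqP]; last by rewrite (negPf px).
  exists (0 < p.[x])%R; rewrite addn0.
  have -> : forall k, var_right k.+1 (0 < p.[x]) p x
                      = var_right k (0 < p.[x])%R p^`() x.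
    by move=> k /=; rewrite (negPf px); case: (0 < p.[x])%R.
  exact: var_right_leq.
have p'0 : p^`() != 0.
  by apply: contraNneq p0 => p'0; rewrite (deriv_eq0_horner p'0 px).
have [|s hs] := IHn r.-1 p^`() p'0 (size_deriv_leq pn).
  by case: r rp => [|r] rp; [rewrite expr0 dvd1p | apply: dvdp_XsubC_exp_deriv].
by exists s; rewrite var_right_root//; move: hs; lia.
Qed.

(** Each of the r leading zeros is a sign change, because p is not zero. *)
Lemma min_var_left_zeros n r p x : p != 0 -> (size p <= n.+1)%N ->
  (('X - x%:P) ^+ r %| p)%R -> (r <= min_var_left n.+1 p x)%N.
Proof.
move=> p0 pn rp.
suff hs s : (r <= var_left n.+1 s p x)%N by rewrite /min_var_left leq_min !hs.
elim: n r p p0 pn rp s => [|n IHn] r p p0 pn rp s.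
  have -> // : r = 0%N.
  by have := leq_trans (dvdp_leq p0 rp) pn; rewrite size_exp_XsubC ltnS leqn0 => /eqP.
case: r rp => // r rp.
have px := dvdp_XsubC_exp_horner rp.
have p'0 : p^`() != 0.
  by apply: contraNneq p0 => p'0; rewrite (deriv_eq0_horner p'0 px).
have := IHn r p^`() p'0 (size_deriv_leq pn) (dvdp_XsubC_exp_deriv rp) (~~ s).
by move=> hs; rewrite var_left_root.
Qed.

Definition zero_free p a b :=
  forall i y, a < y < b -> p^`(i).[y] = 0 -> p^`(i) = 0.

Lemma zero_free_deriv p a b : zero_free p a b -> zero_free p^`() a b.
Proof. by move=> pab i; rewrite -derivSn; apply: pab. Qed.

Lemma zero_free_root p a b y : zero_free p a b -> p != 0 -> a < y < b ->
  p.[y] != 0.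
Proof.
move=> pab p0 yab; apply: contraNneq p0 => py.
by apply/eqP; apply: (pab 0%N y); rewrite ?derivn0.
Qed.

(** Otherwise the intermediate value theorem gives a zero inside ]a, b[. *)
Lemma zero_free_sign p a b y z : zero_free p a b -> a < y < b ->
  a <= z <= b -> p.[z] != 0 -> (0 < p.[y])%R = (0 < p.[z])%R.
Proof.
move=> pab yab zab pz.
have p0 : p != 0 by apply: contraNneq pz => ->; rewrite horner0.
have py := zero_free_root pab p0 yab.
have same_sign u v : u <= v -> a <= u -> v <= b -> ~ p.[u] * p.[v] < 0.
  move=> uv au vb /(poly_ivtoo uv)[w]; rewrite in_itv /= => /andP[uw wv] /rootP.
  by apply/eqP/(zero_free_root pab p0); rewrite (le_lt_trans au) ?(lt_le_trans wv).
case/andP: yab => ay yb; case/andP: zab => az zb.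
have {same_sign} : ~ p.[y] * p.[z] < 0.
  have [yz|/ltW zy] := leP y z; first by apply: same_sign => //; apply: ltW.
  by rewrite mulrC; apply: same_sign => //; apply: ltW.
move: py pz; case: (ltrgt0P p.[y]) => // Hy _; case: (ltrgt0P p.[z]) => // Hz _.
  by case; rewrite pmulr_rlt0.
by case; rewrite nmulr_rlt0.
Qed.

(** By the mean value theorem p leaves its zero at a in the direction of its
    derivative. *)
Lemma zero_free_sign_after_zero p a b y : zero_free p a b -> a < y < b ->
  p.[a] = 0 -> p^`() != 0 -> (0 < p.[y])%R = (0 < p^`().[y])%R.
Proof.
move=> pab yab pa p'0; have /andP[ay yb] := yab.
have [c] := mvt p ay; rewrite in_itv /= pa subr0 => /andP[ac cy] ->.
rewrite pmulr_lgt0 ?subr_gt0//.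
have p'ab := zero_free_deriv pab.
apply: (zero_free_sign p'ab); rewrite ?ac ?(lt_trans cy)//.
  by rewrite !ltW.
exact: zero_free_root p'ab p'0 yab.
Qed.

(** By the mean value theorem p reaches its zero at b against the direction of
    its derivative. *)
Lemma zero_free_sign_before_zero p a b y : zero_free p a b -> a < y < b ->
  p.[b] = 0 -> p^`() != 0 -> (0 < p.[y])%R = ~~ (0 < p^`().[y])%R.
Proof.
move=> pab yab pb p'0; have /andP[ay yb] := yab.
have [c] := mvt p yb; rewrite in_itv /= pb sub0r => /andP[yc cb] E.
have p'ab := zero_free_deriv pab.
have cab : a < c < b by rewrite (lt_trans ay) ?cb.
have p'c := zero_free_root p'ab p'0 cab.
rewrite -[p.[y]]opprK E oppr_gt0 pmulr_llt0 ?subr_gt0//.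
rewrite -(zero_free_sign p'ab cab _ (zero_free_root p'ab p'0 yab)); last first.
  by rewrite !ltW.
by case: (ltrgt0P p^`().[c]) p'c.
Qed.

(** Both sides are equal: a derivative that vanishes at a has, at y, the sign of
    the next derivative, which is the rule of [var_right]. The bound on the size
    makes sure that a next derivative is in the list. *)
Lemma var_right_zero_free n s p a b y : (size p <= n)%N ->
  zero_free p a b -> a < y < b ->
  (var_right n s p y <= var_right n s p a)%N.
Proof.
elim: n s p => // n IHn s p pn pab yab.
have IH := IHn _ _ (size_deriv_leq pn) (zero_free_deriv pab) yab.
have [p0|p0] := eqVneq p 0.
  by have := IH s; rewrite !var_right_root ?p0 ?horner0// deriv0.
have py := zero_free_root pab p0 yab.
have [pa|pa] := eqVneq p.[a] 0; last first.
  rewrite /= (negPf pa) (negPf py).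
  have aab : a <= a <= b by case/andP: yab => ay yb; rewrite lexx ltW ?(lt_trans ay).
  by rewrite (zero_free_sign pab yab aab pa) leq_add2l.
have p'0 : p^`() != 0.
  by apply: contraNneq p0 => p'0; rewrite (deriv_eq0_horner p'0 pa).
rewrite (var_right_root _ _ pa); apply: leq_trans (IH s).
rewrite /= (negPf py) (zero_free_sign_after_zero pab yab pa p'0).
case: n pn {IHn IH} => [|n] pn /=.
  by move: p'0; rewrite -size_poly_leq0 (size_deriv_leq pn).
rewrite (negPf (zero_free_root (zero_free_deriv pab) p'0 yab)).
by rewrite eqxx /= add0n.
Qed.

Lemma var_left_zero_free n s p a b y : (size p <= n)%N ->
  zero_free p a b -> a < y < b ->
  (var_left n s p b <= var_right n s p y)%N.
Proof.
elim: n s p => // n IHn s p pn pab yab.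
have IH := IHn _ _ (size_deriv_leq pn) (zero_free_deriv pab) yab.
have [->|p0] := eqVneq p 0; first by rewrite var_left0.
have py := zero_free_root pab p0 yab.
have [pb|pb] := eqVneq p.[b] 0; last first.
  rewrite /= (negPf p0) (negPf pb) (negPf py).
  have bab : a <= b <= b by case/andP: yab => ay yb; rewrite lexx ltW ?(lt_trans ay).
  by rewrite (zero_free_sign pab yab bab pb) leq_add2l.
have p'0 : p^`() != 0.
  by apply: contraNneq p0 => p'0; rewrite (deriv_eq0_horner p'0 pb).
rewrite (var_left_root _ _ p0 pb).
apply: leq_ltn_trans (IH (~~ s)) _.
rewrite /= (negPf py) (zero_free_sign_before_zero pab yab pb p'0).
case: n pn {IHn IH} => [|n] pn /=.
  by move: p'0; rewrite -size_poly_leq0 (size_deriv_leq pn).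
rewrite (negPf (zero_free_root (zero_free_deriv pab) p'0 yab)).
by case: (0 < p^`().[y])%R s => [] []; rewrite /= ?add0n ?addnA ?leqnn.
Qed.

(** Both counts are compared with the count at the midpoint, where no derivative
    vanishes. *)
Lemma min_var_zero_free n p a b : a < b -> (size p <= n)%N ->
  zero_free p a b -> (min_var_left n p b <= min_var_right n p a)%N.
Proof.
move=> ab pn pab; pose y := (a + b) / 2%:R.
have yab : a < y < b by rewrite /y; lra.
rewrite /min_var_left /min_var_right leq_min !geq_min.
have h s := leq_trans (var_left_zero_free s pn pab yab)
                      (var_right_zero_free s pn pab yab).
by rewrite !h orbT.
Qed.

Lemma count_itv_split (E : seq R) (f : pred R) a b c : a < c < b -> uniq E ->
  count (fun x => (x \in `]a, b[) && f x) E =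
    (count (fun x => (x \in `]a, c[) && f x) E + ((c \in E) && f c)
     + count (fun x => (x \in `]c, b[) && f x) E)%N.
Proof.
move=> /andP[ac cb]; elim: E => //= x E IHE /andP[xE uE].
rewrite {}IHE// in_cons eq_sym; have [xc|xc] := eqVneq x c.
  rewrite xc in xE *; rewrite (negPf xE) !in_itv /= ac cb !ltxx /=; lia.
have -> : (x \in `]a, b[) = (x \in `]a, c[) || (x \in `]c, b[).
  rewrite !in_itv /=; move: xc; case: (ltgtP x c) => //= h _.
    by rewrite (lt_trans h cb) ?andbF ?orbF.
  by rewrite (lt_trans ac h) ?andbF ?orFb.
have : ~~ ((x \in `]a, c[) && (x \in `]c, b[)).
  by rewrite !in_itv /=; case: (ltgtP x c); rewrite ?andbF.
case: (x \in `]a, c[); case: (x \in `]c, b[) => //= _; rewrite ?add0n ?addn0; lia.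
Qed.

Definition critical_points p n a b :=
  roots (\prod_(i < n | p^`(i) != 0) p^`(i)) a b.

Lemma critical_pointsP p n a b i y : (size p <= n)%N -> a < y < b ->
  p^`(i).[y] = 0 -> p^`(i) != 0 -> y \in critical_points p n a b.
Proof.
move=> pn yab piy pi0.
have ltin : (i < n)%N.
  rewrite ltnNge; apply: contraNN pi0 => ni; apply/eqP.
  by rewrite derivn_poly0// (leq_trans pn).
apply: root_in_roots; rewrite ?in_itv//.
  by rewrite prodf_seq_neq0; apply/allP => j _; apply/implyP.
by rewrite (bigD1 (Ordinal ltin))//= rootM /root piy eqxx.
Qed.

(** The interval is cut at the points where some derivative of p vanishes. The
    count is constant between two of them, and [min_var_jump] with q = p says that
    it drops at each zero of p and does not increase elsewhere. *)
Lemma budan_fourier n p a b (E : seq R) : a < b -> p != 0 -> (size p <= n.+1)%N ->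
  uniq E ->
  (count (fun x => (x \in `]a, b[) && (p.[x] == 0)%R) E + min_var_left n.+1 p b
     <= min_var_right n.+1 p a)%N.
Proof.
move=> ab p0 pn uE.
suff split_at (C : seq R) c d : c < d ->
    (forall i y, c < y < d -> p^`(i).[y] = 0 -> p^`(i) != 0 -> y \in C) ->
    (count (fun x => (x \in `]c, d[) && (p.[x] == 0)%R) E + min_var_left n.+1 p d
       <= min_var_right n.+1 p c)%N.
  by apply: (split_at (critical_points p n.+1 a b)) => // i y; apply: critical_pointsP.
elim: C c d => [|e C IHC] c d cd crit.
  have pcd : zero_free p c d.
    by move=> i y ycd piy; apply/eqP; apply: contraT => /(crit _ _ ycd piy).
  rewrite (eq_in_count (a2 := pred0)) ?count_pred0 ?min_var_zero_free//.
  move=> x _ /=; rewrite in_itv; apply/negP => /andP[/= xcd].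
  by apply/negP; apply: zero_free_root xcd.
have [ecd|ecd] := boolP (c < e < d); last first.
  apply: IHC => // i y ycd piy pi0; have := crit i y ycd piy pi0.
  by rewrite in_cons; case: eqVneq => // ye; rewrite -ye ycd in ecd.
have /andP[ce ed] := ecd; rewrite (count_itv_split _ ecd uE).
have IHl : (count (fun x => (x \in `]c, e[) && (p.[x] == 0)%R) E
      + min_var_left n.+1 p e <= min_var_right n.+1 p c)%N.
  apply: IHC => // i y /andP[cy ye] piy pi0.
  have := crit i y; rewrite cy (lt_trans ye)// => /(_ isT piy pi0).
  by rewrite in_cons (lt_eqF ye).
have IHr : (count (fun x => (x \in `]e, d[) && (p.[x] == 0)%R) E
      + min_var_left n.+1 p d <= min_var_right n.+1 p e)%N.
  apply: IHC => // i y /andP[ey yd] piy pi0.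
  have := crit i y; rewrite yd (lt_trans ce)// => /(_ isT piy pi0).
  by rewrite in_cons (gt_eqF ey).
have : ((p.[e] == 0%R) + min_var_right n.+1 p e <= min_var_left n.+1 p e)%N.
  have := @min_var_jump n n p p e p0; rewrite subnn addn0; apply.
  by rewrite subrr dvdp0.
have : ((e \in E) && (p.[e] == 0%R) <= (p.[e] == 0%R))%N by case: (e \in E).
move: IHl IHr; move: (nat_of_bool (_ && _)) (nat_of_bool (p.[e] == 0)) => u v.
move: (count _ _) (count _ _) (min_var_left _ _ _) (min_var_right _ _ _).
move: (min_var_left _ _ _) (min_var_right _ _ _).
lia.
Qed.

End SignVariations.

(** [budan_fourier] on each piece and [min_var_jump] at each knot. A piece
    that is 0 would contain any number of points of E without any sign change. *)
Lemma spline_zeros (R : rcfType) (d : nat) (tau : nat -> R) (r : nat -> nat)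
    (P : nat -> {poly R}) (E : seq R) (i j : nat) :
  uniq E -> {homo tau : a b / (a < b)%N >-> a < b} -> (i < j)%N ->
  (forall l, (i <= l < j)%N -> P l != 0 /\ (size (P l) <= d.+1)%N) ->
  (forall l, (i < l < j)%N -> (0 < r l)%N /\
      (('X - (tau l)%:P) ^+ r l %| P l - P l.-1)%R) ->
  (forall l x, (i <= l < j)%N -> x \in E -> tau l <= x <= tau l.+1 ->
      (P l).[x] = 0) ->
  (count (mem `]tau i, tau j[) E + min_var_left d.+1 (P j.-1) (tau j)
    <= min_var_right d.+1 (P i) (tau i) + \sum_(i.+1 <= l < j) (d.+1 - r l))%N.
Proof.
move=> uE tauS; elim: j => // j IHj; rewrite ltnS leq_eqVlt => /predU1P[<-|ij] hP hr hE.
  have [p0 pn] : P i != 0 /\ (size (P i) <= d.+1)%N by apply: hP; rewrite leqnn ltnSn.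
  rewrite big_geq// addn0 /=.
  apply: leq_trans (budan_fourier (tauS i i.+1 (ltnSn i)) p0 pn uE).
  rewrite leq_add2r; apply/eq_leq/eq_in_count => x xE /=.
  case: (boolP (x \in _)) => //; rewrite in_itv /= => /andP[ix xi].
  have -> : (P i).[x] = 0; last by rewrite eqxx.
  by apply: hE => //; [rewrite leqnn ltnSn | rewrite !ltW].
have IH : (count (mem `]tau i, tau j[) E + min_var_left d.+1 (P j.-1) (tau j)
    <= min_var_right d.+1 (P i) (tau i) + \sum_(i.+1 <= l < j) (d.+1 - r l))%N.
  apply: IHj => // [l|l|l x] /andP[il lj].
  - by apply: hP; rewrite il ltnS ltnW.
  - by apply: hr; rewrite il ltnS ltnW.
  - by apply: hE; rewrite il ltnS ltnW.
have [p0 pn] : P j != 0 /\ (size (P j) <= d.+1)%N by apply: hP; rewrite ltnW//= ltnSn.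
have [q0 _] : P j.-1 != 0 /\ (size (P j.-1) <= d.+1)%N by apply: hP; lia.
have [r0 hrj] : (0 < r j)%N /\ (('X - (tau j)%:P) ^+ r j %| P j - P j.-1)%R.
  by apply: hr; rewrite ij ltnSn.
have BF := budan_fourier (tauS j j.+1 (ltnSn j)) p0 pn uE.
have jump : (((P j.-1).[tau j] == 0%R) + min_var_right d.+1 (P j) (tau j)
    <= min_var_left d.+1 (P j.-1) (tau j) + (d.+1 - r j))%N.
  have := @min_var_jump _ d (r j).-1 _ _ _ q0; rewrite prednK//= => /(_ _ _ hrj) jp.
  by apply: leq_trans jp _; rewrite leq_add2l; lia.
have tj : tau i < tau j < tau j.+1 by rewrite !tauS.
have -> : count (mem `]tau i, tau j.+1[) E
    = count (fun x => (x \in `]tau i, tau j.+1[) && true) E.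
  by apply: eq_count => x; rewrite andbT.
rewrite (count_itv_split predT tj uE) andbT big_nat_recr//=.
have -> : count (fun x => (x \in `]tau i, tau j[) && true) E
    = count (mem `]tau i, tau j[) E by apply: eq_count => x; rewrite andbT.
have -> : count (fun x => (x \in `]tau j, tau j.+1[) && true) E
    = count (fun x => (x \in `]tau j, tau j.+1[) && ((P j).[x] == 0%R)) E.
  apply: eq_in_count => x xE; case: (boolP (x \in _)) => //.
  rewrite in_itv /= => /andP[jx xj].
  have -> : (P j).[x] = 0; last by rewrite eqxx.
  by apply: hE => //; [rewrite ltnW//= ltnSn | rewrite !ltW].
have : ((tau j \in E) <= ((P j.-1).[tau j] == 0%R))%N.
  case: (boolP (tau j \in E)) => // tjE.
  have -> : (P j.-1).[tau j] = 0; last by rewrite eqxx.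
  apply: hE => //; first by lia.
  by rewrite prednK ?lexx ?andbT ?ltW ?tauS//; lia.
move: IH BF jump; move: (nat_of_bool (tau j \in E)) (nat_of_bool (_ == _)) => u v.
move: (\sum_(_ <= l < j) _)%N (count _ _) (count _ _) => S C1 C2.
move: (min_var_right _ _ _) (min_var_right _ _ _) (min_var_left _ _ _).
move: (min_var_left _ _ _) (_ - r j)%N.
lia.
Qed.

(** * Divided differences as functionals of jets *)

Section Subspaces.
Variables (R : realType) (X : Type).

(** A predicate instead of a bundled structure, because it is applied to spaces
    of functions that are only specified on an interval. *)
Definition subspace (C : (X -> R) -> Prop) :=
  C (fun=> 0) /\ forall a u v, C u -> C v -> C (fun x => a * u x + v x).

Variable C : (X -> R) -> Prop.
Hypothesis CS : subspace C.

Lemma subspaceZ a u : C u -> C (fun x => a * u x).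
Proof.
move=> Cu; have := CS.2 a u _ Cu CS.1.
by congr C; apply/funext => x; rewrite addr0.
Qed.

Lemma subspaceD u v : C u -> C v -> C (fun x => u x + v x).
Proof.
move=> Cu Cv; have := CS.2 1 u _ Cu Cv.
by congr C; apply/funext => x; rewrite mul1r.
Qed.

Lemma subspaceB u v : C u -> C v -> C (fun x => u x - v x).
Proof.
move=> Cu Cv; have := CS.2 (-1) v _ Cv Cu.
by congr C; apply/funext => x; rewrite mulN1r addrC.
Qed.

Lemma subspace_sum (I : Type) (r : seq I) (P : pred I) (u : I -> X -> R) :
  (forall i, P i -> C (u i)) -> C (fun x => \sum_(i <- r | P i) u i x).
Proof.
move=> Cu; elim: r => [|i r IHr].
  by have := CS.1; congr C; apply/funext => x; rewrite big_nil.
have [Pi|Pi] := boolP (P i).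
  have := subspaceD (Cu i Pi) IHr.
  by congr C; apply/funext => x; rewrite big_cons Pi.
by move: IHr; congr C; apply/funext => x; rewrite big_cons (negPf Pi).
Qed.

End Subspaces.

Section DividedDifferences.
Variable R : realType.
Implicit Types (D : nat -> R -> R) (y : nat -> R) (n s : nat) (z : R).

(** The divided difference with D s z in the place of the s-th derivative at z.
    It depends only on the derivatives that occur, so the same functional applies
    to truncated powers and to polynomials. *)
Fixpoint jet_difference D n y : R :=
  if y 0%N == y n then D n (y 0%N) / n`!%:R
  else if n is n'.+1 then
    (jet_difference D n' (fun i => y i.+1) - jet_difference D n' y)
      / (y n - y 0%N)
  else 0.

Lemma divided_differenceE (f : R -> R) n y :
  divided_difference f n y = jet_difference (fun s z => (f^`(s))%classic z) n y.
Proof. by elim: n y => //= n IHn y; rewrite !IHn. Qed.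

Definition knot_mult y n z := (\sum_(0 <= i < n.+1) (y i == z))%N.

Definition nondecreasing_upto y n := forall i j, (i <= j <= n)%N -> y i <= y j.

Lemma nondecreasing_upto_behead y n : nondecreasing_upto y n.+1 ->
  nondecreasing_upto (fun i => y i.+1) n.
Proof. by move=> yS i j ij; apply: yS. Qed.

Lemma nondecreasing_upto_belast y n : nondecreasing_upto y n.+1 ->
  nondecreasing_upto y n.
Proof. by move=> yS i j /andP[ij jn]; apply: yS; rewrite ij leqW. Qed.

Lemma nondecreasing_upto_const y n i : nondecreasing_upto y n -> y 0%N = y n ->
  (i <= n)%N -> y i = y 0%N.
Proof.
by move=> yS y0n le_in; apply: le_anti; rewrite {1}y0n !yS// le_in leqnn.
Qed.

Lemma knot_mult_recl y n z :
  knot_mult y n.+1 z = ((y 0%N == z) + knot_mult (fun i => y i.+1) n z)%N.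
Proof. by rewrite /knot_mult big_nat_recl. Qed.

Lemma knot_mult_recr y n z :
  knot_mult y n.+1 z = (knot_mult y n z + (y n.+1 == z))%N.
Proof. by rewrite /knot_mult big_nat_recr. Qed.

Lemma knot_mult_const y n : nondecreasing_upto y n -> y 0%N = y n ->
  knot_mult y n (y n) = n.+1.
Proof.
move=> yS y0n; rewrite /knot_mult big_nat_cond (eq_bigr (fun=> 1%N)).
  by rewrite -big_nat_cond sum_nat_const_nat muln1.
move=> i; rewrite andbT => /andP[_ le_in].
by rewrite -y0n (nondecreasing_upto_const yS)// eqxx.
Qed.

(** A divided difference is a combination of the D s z with s less than the
    multiplicity of z. The closure property says so without naming the
    coefficients. *)
Lemma jet_difference_in (X : Type) (C : (X -> R) -> Prop) (D : X -> nat -> R -> R)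
    n y : subspace C -> nondecreasing_upto y n ->
  (forall z s, (s < knot_mult y n z)%N -> C (fun x => D x s z)) ->
  C (fun x => jet_difference (D x) n y).
Proof.
move=> CS; elim: n y => [|n IHn] y yS Cy.
  have /(subspaceZ CS 1) : C (fun x => D x 0%N (y 0%N)).
    by apply: Cy; rewrite /knot_mult big_nat1 eqxx.
  by congr C; apply/funext => x; rewrite /= eqxx fact0 divr1 mul1r.
have [y0n|y0n] := eqVneq (y 0%N) (y n.+1).
  have /(subspaceZ CS (n.+1`!%:R^-1)) : C (fun x => D x n.+1 (y n.+1)).
    by apply: Cy; rewrite knot_mult_const.
  by congr C; apply/funext => x; rewrite [RHS]/= -y0n eqxx mulrC.
have Cr : C (fun x => jet_difference (D x) n (fun i => y i.+1)).
  apply: IHn (nondecreasing_upto_behead yS) _ => z s sz.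
  by apply: Cy; rewrite knot_mult_recl (leq_trans sz)// leq_addl.
have Cl : C (fun x => jet_difference (D x) n y).
  apply: IHn (nondecreasing_upto_belast yS) _ => z s sz.
  by apply: Cy; rewrite knot_mult_recr (leq_trans sz)// leq_addr.
have := subspaceZ CS (y n.+1 - y 0%N)^-1 (subspaceB CS Cr Cl).
by congr C; apply/funext => x; rewrite /= (negPf y0n) mulrC.
Qed.

(** In this combination the highest derivative at the last knot has a nonzero
    coefficient. Indeed, of the two divided differences in the recursion only the
    one without the first knot contains that derivative. *)
Lemma top_jet_in (X : Type) (C : (X -> R) -> Prop) (D : X -> nat -> R -> R)
    n y : subspace C -> nondecreasing_upto y n ->
  (forall z s, (s < knot_mult y n z)%N ->
     (z == y n) && (s == (knot_mult y n z).-1) = false -> C (fun x => D x s z)) ->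
  C (fun x => jet_difference (D x) n y) ->
  C (fun x => D x (knot_mult y n (y n)).-1 (y n)).
Proof.
move=> CS; elim: n y => [|n IHn] y yS Cy.
  rewrite /knot_mult big_nat1 eqxx /=.
  by congr C; apply/funext => x; rewrite /= eqxx fact0 divr1.
have [y0n|y0n] := eqVneq (y 0%N) (y n.+1).
  move=> /(subspaceZ CS (n.+1`!%:R)); rewrite knot_mult_const//.
  congr C; apply/funext => x; rewrite /= -y0n eqxx mulrC divfK//.
have Cl : C (fun x => jet_difference (D x) n y).
  apply: jet_difference_in => //; first exact: nondecreasing_upto_belast.
  move=> z s sz; apply: Cy; rewrite knot_mult_recr.
    by rewrite (leq_trans sz)// leq_addr.
  by have [zE|//] := eqVneq z (y n.+1); rewrite addn1 /= ltn_eqF.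
move=> /(subspaceZ CS (y n.+1 - y 0%N)) Cd.
have Cr : C (fun x => jet_difference (D x) n (fun i => y i.+1)).
  have := subspaceD CS Cd Cl; congr C; apply/funext => x /=.
  by rewrite (negPf y0n) mulrC divfK ?subrK// subr_eq0 eq_sym.
have -> : knot_mult y n.+1 (y n.+1) = knot_mult (fun i => y i.+1) n (y n.+1).
  by rewrite knot_mult_recl (negPf y0n).
apply: (IHn (fun i => y i.+1)) => //; first exact: nondecreasing_upto_behead.
move=> z s sz ztop; apply: Cy; rewrite knot_mult_recl.
  by rewrite (leq_trans sz)// leq_addl.
have [zn|//] := eqVneq z (y n.+1).
by move: ztop; rewrite /= zn eqxx (negPf y0n).
Qed.

Lemma jet_difference_linear a D1 D2 n y :
  jet_difference (fun s z => a * D1 s z + D2 s z) n y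
    = a * jet_difference D1 n y + jet_difference D2 n y.
Proof.
elim: n y => [|n IHn] y /=; first by case: ifP => _; rewrite ?mulr0 ?addr0// mulrDl mulrA.
case: ifP => _; first by rewrite mulrDl mulrA.
rewrite !IHn !mulrA -mulrDl; congr (_ / _); ring.
Qed.

Definition poly_jet (p : {poly R}) s z := p^`(s).[z].

Lemma jet_difference_const D n y : y 0%N = y n ->
  jet_difference D n y = D n (y 0%N) / n`!%:R.
Proof. by case: n => [|n] /= y0n; [rewrite eqxx | rewrite -y0n eqxx]. Qed.

(** The recursion also holds when all knots coincide, both sides being 0. *)
Lemma jet_difference_rec D n y : nondecreasing_upto y n.+1 ->
  jet_difference D n (fun i => y i.+1) - jet_difference D n y
    = (y n.+1 - y 0%N) * jet_difference D n.+1 y.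
Proof.
move=> yS; have [y0n|y0n] := eqVneq (y 0%N) (y n.+1).
  have yc i : (i <= n.+1)%N -> y i = y 0%N by apply: nondecreasing_upto_const.
  rewrite -y0n subrr mul0r; apply/eqP; rewrite subr_eq0; apply/eqP.
  have y1n : y 1%N = y n.+1 by rewrite -y0n yc.
  rewrite (jet_difference_const (y := fun i => y i.+1) _ y1n) y1n -y0n.
  by rewrite jet_difference_const// yc.
by rewrite /= (negPf y0n) mulrC divfK// subr_eq0 eq_sym.
Qed.

Lemma derivn_mulXsubC (g : {poly R}) z s :
  (('X - z%:P) * g)^`(s.+1) = ('X - z%:P) * g^`(s.+1) + g^`(s) *+ s.+1.
Proof.
elim: s => [|s IHs].
  by rewrite derivn1 derivM derivXsubC mul1r addrC derivn0 mulr1n derivn1.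
rewrite derivnS IHs derivD derivM derivXsubC mul1r derivMn -!derivnS.
by rewrite addrAC -mulrS addrC.
Qed.

(** A factor that vanishes at the last knot removes this knot from the divided
    difference; this is the Leibniz rule for a linear factor. *)
Lemma jet_difference_mulXsubC (g : {poly R}) n y : nondecreasing_upto y n.+1 ->
  jet_difference (poly_jet (('X - (y n.+1)%:P) * g)) n.+1 y
    = jet_difference (poly_jet g) n y.
Proof.
have allequal k u : nondecreasing_upto u k.+1 -> u 0%N = u k.+1 ->
  jet_difference (poly_jet (('X - (u k.+1)%:P) * g)) k.+1 u
    = jet_difference (poly_jet g) k u.
  move=> uS u0; rewrite !jet_difference_const//; last first.
    by rewrite (nondecreasing_upto_const (n := k.+1) uS).
  rewrite /poly_jet derivn_mulXsubC -u0 !hornerE subrr mul0r add0r.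
  rewrite hornerMn factS natrM -mulr_natl invfM mulrACA divff ?mul1r//.
elim: n y => [|n IHn] y yS.
  have [/allequal->//|y0n] := eqVneq (y 0%N) (y 1%N).
  rewrite /= (negPf y0n) !eqxx !fact0 !divr1 /poly_jet !derivn0 !hornerE.
  by rewrite subrr mul0r sub0r -mulNr opprB mulrC mulKf// subr_eq0 eq_sym.
have [/allequal->//|y0n] := eqVneq (y 0%N) (y n.+2).
have y0n' : y n.+2 - y 0%N != 0 by rewrite subr_eq0 eq_sym.
apply: (mulfI y0n'); rewrite -jet_difference_rec//.
rewrite (IHn (fun i => y i.+1)); last exact: nondecreasing_upto_behead.
have -> : jet_difference (poly_jet (('X - (y n.+2)%:P) * g)) n.+1 y
    = (y n.+1 - y n.+2) * jet_difference (poly_jet g) n.+1 y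
      + jet_difference (poly_jet (('X - (y n.+1)%:P) * g)) n.+1 y.
  rewrite -jet_difference_linear; congr jet_difference.
  apply/funext => s; apply/funext => z; rewrite /poly_jet -hornerZ -hornerD.
  rewrite -derivnZ -derivnD; congr (_^`(s).[z]).
  by rewrite -mul_polyC polyCB; ring.
rewrite IHn; last exact: nondecreasing_upto_belast.
have := jet_difference_rec (poly_jet g) (nondecreasing_upto_belast yS).
set A := jet_difference _ n _; set B := jet_difference _ n _.
set G := jet_difference _ n.+1 _; clearbody A B G => /eqP.
rewrite subr_eq => /eqP ->; ring.
Qed.

Lemma jet_difference_polyC c n y : jet_difference (poly_jet c%:P) n.+1 y = 0.
Proof.
have jet0 k u : u 0%N = u k.+1 -> jet_difference (poly_jet c%:P) k.+1 u = 0.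
  by move=> u0; rewrite jet_difference_const// /poly_jet derivnC horner0 mul0r.
elim: n y => [|n IHn] y.
  have [/jet0//|y0n] := eqVneq (y 0%N) (y 1%N).
  by rewrite /= (negPf y0n) !eqxx !fact0 /poly_jet !derivn0 !hornerC subrr mul0r.
have [/jet0//|y0n] := eqVneq (y 0%N) (y n.+2).
rewrite [jet_difference _ _ _]/= (negPf y0n) -!/(jet_difference _ n.+1 _).
by rewrite !IHn subrr mul0r.
Qed.

(** Subtracting p (y n) leaves a multiple of X - y n, so that the degree and the
    number of knots go down together. *)
Lemma jet_difference_poly (p : {poly R}) n y : nondecreasing_upto y n ->
  (size p <= n)%N -> jet_difference (poly_jet p) n y = 0.
Proof.
elim: n p y => [|n IHn] p y yS pn.
  have /eqP-> : p == 0 by rewrite -size_poly_leq0.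
  by rewrite jet_difference_const// /poly_jet derivn0 horner0 mul0r.
have /factor_theorem[g pg] : root (p - (p.[y n.+1])%:P) (y n.+1).
  by rewrite rootE !hornerE subrr.
have -> : poly_jet p = (fun s z => 1 * poly_jet (('X - (y n.+1)%:P) * g) s z
                                  + poly_jet (p.[y n.+1])%:P s z).
  apply/funext => s; apply/funext => z; rewrite mul1r /poly_jet -hornerD -derivnD.
  by rewrite mulrC -pg subrK.
rewrite jet_difference_linear jet_difference_polyC addr0 mul1r.
rewrite jet_difference_mulXsubC// IHn//; first exact: nondecreasing_upto_belast.
have [->|g0] := eqVneq g 0; first by rewrite size_poly0.
have : (size (p - (p.[y n.+1])%:P)%R <= n.+1)%N.
  rewrite (leq_trans (size_polyD _ _))// geq_max pn size_polyN size_polyC.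
  by rewrite (leq_trans (leq_b1 _)).
by rewrite pg size_mul ?polyXsubC_eq0// size_XsubC addn2.
Qed.

End DividedDifferences.

(** * Truncated powers *)

Section TruncatedPowers.
Variable R : realType.
Implicit Types (x z : R) (n s q : nat).

Definition trunc_pow q x z : R := Num.max (z - x) 0 ^+ q.

Lemma trunc_pow_poly q x z : x <= z -> trunc_pow q x z = (z - x) ^+ q.
Proof. by move=> xz; rewrite /trunc_pow max_l// subr_ge0. Qed.

Lemma trunc_pow_eq0 q x z : (0 < q)%N -> z <= x -> trunc_pow q x z = 0.
Proof.
by move=> q0 zx; rewrite /trunc_pow max_r ?subr_le0// expr0n; case: q q0.
Qed.

(** At z = x the difference quotient is h_+^(q+1), which is bounded by |h|. *)
Lemma is_derive_trunc_pow q x z :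
  is_derive z (1 : R) (trunc_pow q.+2 x) (q.+2%:R * trunc_pow q.+1 x z).
Proof.
have [zx|xz|->] := ltrgtP z x.
- rewrite trunc_pow_eq0 ?ltW// mulr0.
  apply: (near_eq_is_derive (f := cst 0)).
  near=> w; rewrite trunc_pow_eq0// ltW//; near: w; exact: lt_nbhsl.
- rewrite trunc_pow_poly ?ltW//.
  apply: (near_eq_is_derive (f := (id - cst x) ^+ q.+2)).
    near=> w; rewrite trunc_pow_poly ?ltW//; last by near: w; exact: lt_nbhsr.
    by rewrite !fctE.
  have := @is_deriveX R R (id - cst x) q.+2 z 1 (1 - 0) 
    (is_deriveB (is_derive_id z 1) (is_derive_cst x z 1)).
  by rewrite subr0 /GRing.scale /= mulr1 !fctE.
- rewrite (trunc_pow_eq0 _ (lexx x))// mulr0.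
  have lim0 : ((fun h : R => h^-1 *: ((trunc_pow q.+2 x \o shift x) (h *: (1 : R))
      - trunc_pow q.+2 x x)) @ 0^' --> (0 : R))%classic.
    apply: (@cvg_to_0_linear _ _ 1 1) => // h /andP[h0 h1].
    rewrite (trunc_pow_eq0 _ (lexx x))// subr0 /shift /= /trunc_pow.
    rewrite [h *: 1]mulr1 addrK /GRing.scale /=.
    have hn0 : h != 0 by rewrite -normr_gt0.
    case: (ltrgtP h 0) hn0 => [hneg|hpos|//] _.
      by rewrite expr0n mulr0 normr0 mulr_ge0.
    rewrite exprS mulKf ?gt_eqF// mul1r normrX exprS.
    by rewrite ler_piMr// exprn_ile1// ltW.
  by split; [apply/cvg_ex; exists 0 | apply: cvg_lim].
Unshelve. all: by end_near.
Qed.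

Lemma derive1n_trunc_pow n s x : (s < n)%N ->
  (trunc_pow n x)^`(s)%classic = fun z => (n ^_ s)%:R * trunc_pow (n - s) x z.
Proof.
elim: s => [|s IHs] sn.
  by rewrite derive1n0 subn0 ffactn0; apply/funext => z; rewrite mul1r.
rewrite derive1nS IHs; last exact: ltnW.
apply/funext => z; rewrite derive1E.
have [q qE] : exists q, (n - s)%N = q.+2 by exists (n - s - 2)%N; lia.
have dq := is_derive_trunc_pow q x z.
rewrite qE (_ : (fun z => _) = (n ^_ s)%:R \*: trunc_pow q.+2 x)//.
have dd : derivable (trunc_pow q.+2 x) z 1 by exact: ex_derive.
rewrite deriveZ// derive_val.
rewrite /GRing.scale /= mulrA -natrM ffactnSr qE.
congr ((_ * _)%:R * trunc_pow _ _ _); lia.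
Qed.

End TruncatedPowers.

(** * The knots of a B-spline *)

Section FlattenNseq.
Variables (R : realDomainType) (g : nat -> R) (f : nat -> nat).

Lemma count_flatten_nseq (r : seq nat) z :
  count_mem z (flatten [seq nseq (f j) (g j) | j <- r])
    = (\sum_(j <- r) (g j == z) * f j)%N.
Proof.
elim: r => [|j r IHr]; first by rewrite big_nil.
by rewrite big_cons /= count_cat IHr count_nseq.
Qed.

Lemma sorted_flatten_nseq n : {homo g : a b / (a < b)%N >-> a < b} ->
  sorted <=%R (flatten [seq nseq (f j) (g j) | j <- iota 0 n]).
Proof.
move=> gS; have gle a b : (a <= b)%N -> g a <= g b.
  by rewrite leq_eqVlt => /predU1P[->//|/gS/ltW].
rewrite sorted_pairwise; last exact: le_trans.
elim: {1}n 0%N => //= k IHk a; rewrite pairwise_cat IHk andbT; apply/andP; split.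
  apply/allrelP => x y /nseqP[-> _] /flattenP[s /mapP[j jr ->] /nseqP[-> _]].
  by apply: gle; move: jr; rewrite mem_iota => /andP[/ltnW].
by elim: (f a) => //= q IHq; rewrite IHq andbT all_nseq lexx orbT.
Qed.

End FlattenNseq.

Section BSplines.
Variables (R : realType) (m : nat) (t : int -> R) (mu : int -> nat).
Hypothesis ht : forall i : int, t i < t (i + 1).
Hypothesis hmu : forall i : int, (1 <= mu i <= m)%N.

Lemma knot_lt : {homo t : i j / i < j}.
Proof.
move=> i j ij.
have [n ->] : exists n : nat, j = i + n.+1%:Z.
  by exists (absz (j - i)).-1; lia.
elim: n => [|n IHn]; first exact: ht.
by apply: lt_trans IHn _; have := ht (i + n.+1%:Z); congr (_ < t _); lia.
Qed.

Lemma knot_le : {homo t : i j / i <= j}.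
Proof. by move=> i j; rewrite le_eqVlt => /predU1P[->//|/knot_lt/ltW]. Qed.

Lemma knot_inj : injective t.
Proof.
by move=> i j tij; case: (ltrgtP i j) => // /knot_lt; rewrite tij ltxx.
Qed.

(** The multiplicity of t (i + j) in the knot sequence of Q_{i,l}. It allows the
    first and the last knot to be treated like the others. *)
Definition index_mult i l j :=
  if j == 0%N then l
  else if j == last_knot m mu i l then last_mult m mu i l j
  else mu (i + j%:Z).

Variables (i : int) (l : nat).
Hypothesis hl : (1 <= l <= mu i)%N.
Let n := last_knot m mu i l.
Let r := last_mult m mu i l n.

Lemma last_knotP : is_last_knot m mu i l n.
Proof.
have [p [hp _]] := last_knot_uniq hmu hl.
exact: (@getPex _ (is_last_knot m mu i l) (ex_intro _ p hp)).
Qed.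

Lemma last_knot_gt0 : (0 < n)%N. Proof. by case: last_knotP. Qed.

Lemma last_mult_bounds : (1 <= r <= mu (i + n%:Z))%N.
Proof. by case: last_knotP. Qed.

Lemma last_mult_sum : (l + \sum_(1 <= j < n) mu (i + j%:Z)%R + r = m + 2)%N.
Proof.
by have := last_mult_bounds; rewrite /r /last_mult; lia.
Qed.

Lemma last_knot_leq : (n <= m.+1)%N.
Proof.
have : (\sum_(1 <= j < n) 1 <= \sum_(1 <= j < n) mu (i + j%:Z)%R)%N.
  by apply: leq_sum => j _; case/andP: (hmu (i + j%:Z)).
rewrite sum_nat_const_nat; have := last_mult_sum; have := last_mult_bounds; lia.
Qed.

Lemma index_mult_leq j : (j <= n)%N -> (index_mult i l j <= mu (i + j%:Z))%N.
Proof.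
move=> jn; rewrite /index_mult; case: eqP => [->|_]; first by rewrite addr0; case/andP: hl.
by case: eqP => [->|//]; case/andP: last_mult_bounds.
Qed.

Lemma index_mult_last : index_mult i l n = r.
Proof. by rewrite /index_mult -/n gtn_eqF ?last_knot_gt0 // eqxx. Qed.

(** A single formula for the knot sequence, from which its order, size and
    multiplicities are read off. *)
Lemma knotsE : knots m t mu i l
  = flatten [seq nseq (index_mult i l j) (t (i + j%:Z)) | j <- iota 0 n.+1].
Proof.
rewrite /knots -/n -/r.
have iotaE k : (0 < k)%N -> iota 1 k = rcons (index_iota 1 k) k.
  by case: k => // k _; rewrite -(addn1 k) iotaD cats1 /index_iota addnK add1n addn1.
rewrite [iota _ _]/= iotaE ?last_knot_gt0//.
rewrite map_cons map_rcons /= flatten_rcons addr0 index_mult_last.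
congr (_ ++ (flatten _ ++ _)); apply/eq_in_map => j.
by rewrite mem_index_iota /index_mult -/n => /andP[j1 jn]; rewrite gtn_eqF// ltn_eqF.
Qed.

Lemma size_knots : size (knots m t mu i l) = m.+2.
Proof.
rewrite /knots !size_cat !size_nseq size_flatten /shape -map_comp.
rewrite (eq_map (g := fun j => mu (i + j%:Z))); last by move=> j /=; rewrite size_nseq.
by rewrite sumnE big_map; have := last_mult_sum; rewrite -/n -/r; lia.
Qed.

Lemma knots_nondecreasing : nondecreasing_upto (nth 0%R (knots m t mu i l)) m.+1.
Proof.
move=> a b /andP[ab bm].
have ks : sorted <=%R (knots m t mu i l).
  by rewrite knotsE; apply: sorted_flatten_nseq => a' b' ab'; apply: knot_lt; lia.
by apply: (sorted_leq_nth le_trans lexx) => //; rewrite inE size_knots; lia.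
Qed.

Lemma knot_mult_count z :
  knot_mult (nth 0%R (knots m t mu i l)) m.+1 z = count_mem z (knots m t mu i l).
Proof.
rewrite /knot_mult -size_knots -sum1_count [RHS]big_mkcond /=.
rewrite [RHS](big_nth 0); apply: eq_bigr => a _.
by case: eqP.
Qed.

Lemma knot_mult_index j : (j <= n)%N ->
  knot_mult (nth 0%R (knots m t mu i l)) m.+1 (t (i + j%:Z)) = index_mult i l j.
Proof.
move=> jn; rewrite knot_mult_count knotsE.
rewrite (@count_flatten_nseq _ (fun j => t (i + j%:Z))).
rewrite (bigD1_seq j) ?iota_uniq ?mem_iota//= eqxx mul1n big1 ?addn0// => a aj.
by case: eqP => // /knot_inj/addrI[]/eqP; rewrite (negPf aj).
Qed.

Lemma knot_mult_gt z s :
  (s < knot_mult (nth 0%R (knots m t mu i l)) m.+1 z)%N ->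
  exists2 j, (j <= n)%N & z = t (i + j%:Z) /\ (s < index_mult i l j)%N.
Proof.
move=> sz; have : z \in knots m t mu i l.
  by rewrite -has_pred1 has_count -knot_mult_count; lia.
rewrite knotsE => /flattenP[u /mapP[j jn ->] /nseqP[zj _]].
have {}jn : (j <= n)%N by move: jn; rewrite mem_iota.
by exists j => //; split=> //; rewrite -knot_mult_index// -zj.
Qed.

Let y := nth 0%R (knots m t mu i l).

Lemma QE x :
  Q m t mu i l x = jet_difference (fun s z => (trunc_pow m x)^`(s)%classic z) m.+1 y.
Proof. by rewrite /Q /bspline divided_differenceE. Qed.

Lemma jet_trunc_pow_in (C : (R -> R) -> Prop) j s : subspace C ->
  (j <= n)%N -> (s < index_mult i l j)%N ->
  C (fun x => trunc_pow (m - s) x (t (i + j%:Z))) ->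
  C (fun x => (trunc_pow m x)^`(s)%classic (t (i + j%:Z))).
Proof.
move=> CS jn sj /(subspaceZ CS (m ^_ s)%:R); congr C; apply/funext => x.
rewrite derive1n_trunc_pow//.
by have := index_mult_leq jn; have := hmu (i + j%:Z); lia.
Qed.

Lemma Q_in (C : (R -> R) -> Prop) : subspace C ->
  (forall j s, (j <= n)%N -> (s < mu (i + j%:Z))%N ->
     C (fun x => trunc_pow (m - s) x (t (i + j%:Z)))) ->
  C (Q m t mu i l).
Proof.
move=> CS Ct; have -> : Q m t mu i l = fun x =>
    jet_difference (fun s z => (trunc_pow m x)^`(s)%classic z) m.+1 y.
  by apply/funext => x; rewrite QE.
apply: (jet_difference_in (D := fun x s z => (trunc_pow m x)^`(s)%classic z)) => //.
  exact: knots_nondecreasing.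
move=> z s /knot_mult_gt[j jn [-> sj]]; apply: jet_trunc_pow_in => //.
by apply: Ct => //; apply: leq_trans (index_mult_leq jn).
Qed.

(** The B-spline is triangular with respect to its last knot, so the last
    truncated power is recovered from the B-spline and the earlier ones. *)
Lemma last_trunc_pow_in (C : (R -> R) -> Prop) : subspace C ->
  (forall j s, (j < n)%N -> (s < mu (i + j%:Z))%N ->
     C (fun x => trunc_pow (m - s) x (t (i + j%:Z)))) ->
  (forall s, (s < r.-1)%N -> C (fun x => trunc_pow (m - s) x (t (i + n%:Z)))) ->
  C (Q m t mu i l) ->
  C (fun x => trunc_pow (m - r.-1) x (t (i + n%:Z))).
Proof.
move=> CS Ct Cn CQ.
have yn : y m.+1 = t (i + n%:Z).
  have -> : y m.+1 = last 0 (knots m t mu i l) by rewrite /y -nth_last size_knots.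
  rewrite /knots -/n -/r; have := last_mult_bounds; case: (r) => //= q _.
  by rewrite !last_cat /=; elim: q => //= q <-; case: q.
have rE : knot_mult y m.+1 (y m.+1) = r.
  by rewrite yn knot_mult_index// index_mult_last.
have rm : (r.-1 < m)%N.
  by have := last_mult_bounds; have := hmu (i + n%:Z); lia.
have := @top_jet_in _ _ C (fun x s z => (trunc_pow m x)^`(s)%classic z) m.+1 y CS
   knots_nondecreasing.
rewrite rE yn => top.
have /(subspaceZ CS ((m ^_ r.-1)%:R^-1)) :
    C (fun x => (trunc_pow m x)^`(r.-1)%classic (t (i + n%:Z))).
  apply: top; last by move: CQ; congr C; apply/funext => x; rewrite QE.
  move=> z s /knot_mult_gt[j jn [-> sj]].
  have [jE|jE] := eqVneq j n.
    rewrite jE eqxx /= -yn rE yn => sr.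
    move: sj; rewrite jE index_mult_last => sj.
    apply: jet_trunc_pow_in; rewrite ?index_mult_last//.
    by apply: Cn; move: sr sj; case: eqP => //; lia.
  move=> _; apply: jet_trunc_pow_in => //; apply: Ct.
    by rewrite ltn_neqAle jE.
  exact: leq_trans (index_mult_leq jn).
congr C; apply/funext => x; rewrite derive1n_trunc_pow// mulKf//.
by rewrite pnatr_eq0 -lt0n ffact_gt0 ltnW.
Qed.

Lemma Q_right x : t (i + n%:Z) <= x -> Q m t mu i l x = 0.
Proof.
move=> tx; apply: (Q_in (C := fun u => u x = 0)).
  by split=> // a u v -> ->; rewrite mulr0 addr0.
move=> j s jn sj; apply: trunc_pow_eq0; first by have := hmu (i + j%:Z); lia.
by apply: le_trans tx; apply: knot_le; lia.
Qed.

Lemma derivn_XsubC_exp (a : R) q s :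
  (('X - a%:P) ^+ q)^`(s) = ('X - a%:P) ^+ (q - s) *+ (q ^_ s).
Proof.
elim: s => [|s IHs]; first by rewrite subn0 ffactn0.
rewrite derivnS IHs derivMn deriv_exp derivXsubC mul1r -mulrnA.
by rewrite ffactnSr mulnC subnS.
Qed.

(** To the left of all knots the truncated power is the polynomial (z - x)^m in z,
    whose divided difference of order m + 1 is 0. *)
Lemma Q_left x : x <= t i -> Q m t mu i l x = 0.
Proof.
move=> xt.
(* Agreement of two families of jets is a subspace of functions on bool, so that
   jet_difference_in transfers it to the divided differences. *)
pose D (b : bool) s z :=
  if b then (trunc_pow m x)^`(s)%classic z else poly_jet (('X - x%:P) ^+ m) s z.
have := @jet_difference_in _ _ (fun u => u true = u false) D m.+1 y _ knots_nondecreasing.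
rewrite QE /D => ->; last 1 first.
- move=> z s /knot_mult_gt[j jn [-> sj]].
  have sm : (s < m)%N by have := index_mult_leq jn; have := hmu (i + j%:Z); lia.
  rewrite derive1n_trunc_pow// trunc_pow_poly.
    by rewrite /poly_jet derivn_XsubC_exp hornerMn horner_exp hornerXsubC mulr_natl.
  by apply: le_trans xt _; apply: knot_le; lia.
- by apply: jet_difference_poly; [exact: knots_nondecreasing | rewrite size_exp_XsubC].
- by split=> // a u v -> ->.
Qed.

End BSplines.

(** Each copy r of each knot t j ends exactly one run of m + 2 consecutive knots,
    found by counting back from it. *)
Lemma last_knot_surj (m : nat) (mu : int -> nat)
    (hmu : forall i : int, (1 <= mu i <= m)%N) (j : int) (r : nat) :
  (1 <= r <= mu j)%N ->
  exists i l, [/\ (1 <= l <= mu i)%N, i + (last_knot m mu i l)%:Z = j &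
                  last_mult m mu i l (last_knot m mu i l) = r].
Proof.
move=> hr.
pose S n := (\sum_(1 <= a < n) mu (j - a%:Z)%R)%N.
have S1 : S 1%N = 0%N by rewrite /S big_geq.
have SS n : (1 <= n)%N -> S n.+1 = (S n + mu (j - n%:Z)%R)%N.
  by move=> n1; rewrite /S big_nat_recr.
have S_ge n : (n <= S n.+1)%N.
  elim: n => // n IHn; rewrite SS//.
  by have := hmu (j - n.+1%:Z)%R; move: IHn; lia.
have ex : exists n, (m + 2 <= r + S n.+1)%N.
  by exists (m + 2)%N; have := S_ge (m + 2)%N; lia.
case: (ex_minnP ex) => n hn minn.
have hj := hmu j.
have n1 : (1 <= n)%N by case: n hn {minn} => //; rewrite S1; lia.
have hlt : (r + S n < m + 2)%N.
  rewrite ltnNge; apply/negP => h.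
  by have := minn n.-1; rewrite prednK// => /(_ h); lia.
pose i := j - n%:Z; pose l := (m + 2 - (r + S n))%N.
have hl : (1 <= l <= mu i)%N.
  by rewrite /l /i; move: hn; rewrite SS//; lia.
have SE : S n = (\sum_(1 <= a < n) mu (i + a%:Z)%R)%N.
  rewrite /S big_nat_rev /=; apply: eq_big_nat => a /andP[a1 an].
  by congr mu; rewrite /i; lia.
have rE : last_mult m mu i l n = r.
  by rewrite /last_mult -SE /l; lia.
have ln : is_last_knot m mu i l n.
  by split=> //; rewrite rE (_ : i + n%:Z = j)// /i subrK.
have lE : last_knot m mu i l = n.
  have [p [_ pu]] := last_knot_uniq hmu hl.
  by rewrite -(pu _ ln) -(pu _ (last_knotP hmu hl)).
by exists i, l; split=> //; rewrite lE// /i subrK.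
Qed.

(** * The real spline space on the interval *)

Section SplineSpaceOnInterval.
Variables (R : realType) (m k : nat) (t : int -> R) (mu : int -> nat).
Hypothesis ht : forall i : int, t i < t (i + 1).
Hypothesis hmu : forall i : int, (1 <= mu i <= m)%N.

Definition in_range (x : R) := t 0 <= x <= t k%:Z.

(** Only the B-splines with - (m + 1) <= i < k can be nonzero on [t 0, t k], as a
    B-spline has at most m + 2 distinct knots. *)
Definition active_index (p : 'I_(k + m.+1)) : int := (p : nat)%:Z - m.+1%:Z.

(** The pairs (i, l) with l <= mu i are embedded in a product of ordinals, the
    other pairs being sent to 0; this gives a finite spanning family. *)
Definition active_Q (pq : 'I_(k + m.+1) * 'I_m) (x : R) : R :=
  if (pq.2 < mu (active_index pq.1))%N then Q m t mu (active_index pq.1) pq.2.+1 x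
  else 0.

Definition real_spline (u : R -> R) := exists c : 'I_(k + m.+1) * 'I_m -> R,
  forall x, in_range x -> u x = \sum_pq c pq * active_Q pq x.

Lemma real_spline_subspace : subspace real_spline.
Proof.
split.
  by exists (fun=> 0) => x _; rewrite big1// => pq _; rewrite mul0r.
move=> a u v [c cu] [d dv]; exists (fun pq => a * c pq + d pq) => x xI.
rewrite cu// dv// mulr_sumr -big_split /=.
by apply: eq_bigr => pq _; rewrite mulrDl mulrA.
Qed.

Lemma real_spline_eq u v : (forall x, in_range x -> u x = v x) ->
  real_spline u -> real_spline v.
Proof. by move=> uv [c cu]; exists c => x xI; rewrite -uv// cu. Qed.

Lemma active_Q_real_spline pq : real_spline (active_Q pq).
Proof.
exists (fun ij => (ij == pq)%:R) => x _.
rewrite (bigD1 pq)//= eqxx mul1r big1 ?addr0// => ij /negPf->.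
by rewrite mul0r.
Qed.

Lemma Q_inactive i l x : (1 <= l <= mu i)%N -> in_range x ->
  (i < - m.+1%:Z) || (k%:Z <= i) -> Q m t mu i l x = 0.
Proof.
move=> hl /andP[x0 xk] /orP[ilow|ihigh]; last first.
  by apply: Q_left => //; apply: le_trans xk _; apply: knot_le.
apply: Q_right => //; apply: le_trans x0; apply: knot_le => //.
have := last_knot_leq hmu hl; lia.
Qed.

Lemma active_indexP (i : int) : - m.+1%:Z <= i < k%:Z ->
  exists p, active_index p = i.
Proof.
move=> /andP[i1 i2]; have pk : (absz (i + m.+1%:Z)%R < k + m.+1)%N by lia.
by exists (Ordinal pk); rewrite /active_index /=; lia.
Qed.

Lemma Q_real_spline i l : (1 <= l <= mu i)%N -> real_spline (Q m t mu i l).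
Proof.
move=> hl; have [act|inact] := boolP (- m.+1%:Z <= i < k%:Z); last first.
  apply: (real_spline_eq (u := fun=> 0)); last exact: real_spline_subspace.1.
  by move=> x xI; rewrite Q_inactive//; move: inact; lia.
have [p pi] := active_indexP act.
have lm : (l.-1 < m)%N by have := hmu i; lia.
apply: (real_spline_eq (u := active_Q (p, Ordinal lm))); last exact: active_Q_real_spline.
by move=> x _; case/andP: hl => l1 lmu; rewrite /active_Q /= pi prednK// lmu.
Qed.

(** Induction on the last knot, [last_trunc_pow_in] recovering one function at a
    time. It starts with the knots t j, j <= 0, for which the function vanishes on
    [t 0, t k]. *)
Lemma trunc_pow_real_spline (j : int) s : (s < mu j)%N ->
  real_spline (fun x => trunc_pow (m - s) x (t j)).
Proof.
have j0 (i : int) q : i <= 0 -> (q < mu i)%N ->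
    real_spline (fun x => trunc_pow (m - q) x (t i)).
  move=> i0 qi; apply: (real_spline_eq (u := fun=> 0)); last exact: real_spline_subspace.1.
  move=> x /andP[x0 _]; rewrite trunc_pow_eq0//; first by have := hmu i; lia.
  by apply: le_trans x0; apply: knot_le.
suff main (n : nat) : forall i : int, i <= n%:Z -> forall q, (q < mu i)%N ->
    real_spline (fun x => trunc_pow (m - q) x (t i)).
  by apply: (main (absz j)); lia.
elim: n => [|n IHn] i; first by move=> i0 q; apply: j0.
move=> i_le q; have [in_|in_] := leP i n%:Z; first exact: IHn.
have {i_le in_} -> : i = n.+1%:Z by lia.
elim/ltn_ind: q => q IHq qn.
have [|i0 [l [hl iE rE]]] := @last_knot_surj m mu hmu n.+1%:Z q.+1; first by lia.
have := @last_trunc_pow_in R m t mu ht hmu i0 l hl real_spline real_spline_subspace.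
rewrite rE iE /=; apply; last exact: Q_real_spline.
  by move=> j' s' j's; apply: IHn; lia.
by move=> s' s'q; apply: IHq => //; lia.
Qed.

(** The coefficients of (a - x)^m in powers of x are, up to nonzero factors, the
    powers of a, so that the Vandermonde matrix of the nodes can be inverted. *)
Lemma monomial_in (C : (R -> R) -> Prop) (a : 'I_m.+1 -> R) : subspace C ->
  injective a -> (forall i, C (fun x => (a i - x) ^+ m)) ->
  forall e, (e <= m)%N -> C (fun x => x ^+ e).
Proof.
move=> CS ainj Ca e em.
pose V := Vandermonde m.+1 (\row_j a j).
have Vu : V \in unitmx.
  rewrite unitmxE det_Vandermonde unitfE prodf_seq_neq0; apply/allP => i _ /=.
  rewrite prodf_seq_neq0; apply/allP => j _; apply/implyP => ij.
  by rewrite !mxE subr_eq0 (inj_eq ainj); apply: contraTneq ij => ->; rewrite ltnn.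
(* In (a - x)^m the power x^e comes with a^(m - e). *)
pose e' : 'I_m.+1 := inord (m - e).
have e'E : e' = (m - e)%N :> nat by rewrite inordK// ltnS leq_subr.
pose c j := invmx V j e'.
have cV (i : 'I_m.+1) : \sum_j a j ^+ i * c j = (i == e')%:R.
  have := congr1 (fun M : 'M[R]_m.+1 => M i e') (mulmxV Vu); rewrite !mxE => <-.
  by apply: eq_bigr => j _; rewrite !mxE.
have : C (fun x => (-1) ^+ e * ('C(m, e)%:R)^-1 * (\sum_j c j * (a j - x) ^+ m)).
  apply: subspaceZ => //; apply: subspace_sum => // j _; exact: subspaceZ.
congr C; apply/funext => x.
have -> : \sum_j c j * (a j - x) ^+ m = 'C(m, e)%:R * (- x) ^+ e.
  transitivity (\sum_(i < m.+1) (\sum_j a j ^+ (m - i) * c j) * (- x) ^+ i *+ 'C(m, i)).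
    under eq_bigr => j _ do rewrite exprDn mulr_sumr.
    rewrite exchange_big /=; apply: eq_bigr => i _.
    rewrite mulr_suml -sumrMnl; apply: eq_bigr => j _.
    by rewrite mulrnAr mulrA [c j * _]mulrC.
  have eE : (inord e : 'I_m.+1) = e :> nat by rewrite inordK.
  rewrite (bigD1 (inord e))//= [X in _ + X]big1 ?addr0 => [|i ie].
    rewrite eE -e'E cV eqxx mul1r mulr_natl; reflexivity.
  have ->: \sum_j a j ^+ (m - i) * c j = 0; last by rewrite mul0r mul0rn.
  have iE : (inord (m - i) : 'I_m.+1) = (m - i)%N :> nat by rewrite inordK// ltnS leq_subr.
  rewrite -iE cV; case: eqP => // /(congr1 val) /=; rewrite e'E iE => mi.
  case/eqP: ie; apply: val_inj => /=; rewrite eE.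
  by have := ltn_ord i; lia.
rewrite mulrA -[X in X * _]mulrA mulVf ?mulr1; last by rewrite pnatr_eq0 -lt0n bin_gt0.
by rewrite -exprMn mulN1r opprK.
Qed.

(** On [t 0, t k] the truncated powers with knots t k, ..., t (k + m) are the
    polynomials (t j - x)^m with m + 1 distinct nodes. *)
Lemma polynomial_real_spline (p : {poly R}) : (size p <= m.+1)%N ->
  real_spline (fun x => p.[x]).
Proof.
move=> pm.
have CS := real_spline_subspace.
have mono e : (e <= m)%N -> real_spline (fun x => x ^+ e).
  apply: (@monomial_in _ (fun i => t (k%:Z + i%:Z)) CS).
    by move=> i j /(knot_inj ht)/addrI[] ij; apply: val_inj.
  move=> i; have mu0 : (0 < mu (k%:Z + i%:Z))%N by case/andP: (hmu (k%:Z + i%:Z)).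
  apply: real_spline_eq (trunc_pow_real_spline mu0) => x /andP[_ xk].
  by rewrite subn0 trunc_pow_poly// (le_trans xk)// knot_le//; lia.
have : real_spline (fun x => \sum_(e < m.+1) p`_e * x ^+ e).
  by apply: subspace_sum => // e _; apply: subspaceZ => //; apply: mono; rewrite -ltnS.
by congr real_spline; apply/funext => x; rewrite (horner_coef_wide _ pm).
Qed.

(** Left and right truncated powers differ by a polynomial, up to sign. *)
Lemma right_trunc_pow_real_spline (j : int) q : (m - mu j < q <= m)%N ->
  real_spline (fun x => Num.max (x - t j) 0 ^+ q).
Proof.
move=> hq; have CS := real_spline_subspace.
have Cp : real_spline (fun x => (('X - (t j)%:P) ^+ q).[x]).
  by apply: polynomial_real_spline; rewrite size_exp_XsubC; case/andP: hq.
have Ct : real_spline (fun x => trunc_pow q x (t j)).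
  have /trunc_pow_real_spline : (m - q < mu j)%N by have := hmu j; lia.
  by rewrite subKn//; case/andP: hq.
have := subspaceB CS Cp (subspaceZ CS ((-1) ^+ q) Ct).
congr real_spline; apply/funext => x; rewrite horner_exp hornerXsubC /trunc_pow.
have q0 : (0 < q)%N by lia.
have [xt|tx] := leP x (t j).
  rewrite [in LHS]max_l ?subr_ge0// [in RHS]max_r ?subr_le0//.
  by rewrite -exprMn mulN1r opprB subrr expr0n; case: q q0 {hq Cp Ct}.
rewrite [Num.max (t j - x) _]max_r ?subr_le0 ?ltW// max_l ?subr_ge0 ?ltW//.
by rewrite expr0n gtn_eqF// mulr0 subr0.
Qed.

End SplineSpaceOnInterval.

(** * Products of splines and piecewise polynomials of double degree *)

Section PiecewisePolynomials.
Variables (R : realType) (k : nat) (t : int -> R).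
Hypothesis ht : forall i : int, t i < t (i + 1).

(** Smoothness of order r l at t l is divisibility of the jump by (X - t l)^(r l),
    which makes sense for polynomials alone. *)
Definition piecewise (d : nat) (r : nat -> nat) (P : nat -> {poly R}) :=
  (forall l, (l < k)%N -> (size (P l) <= d.+1)%N) /\
  (forall l, (0 < l < k)%N -> (('X - (t l%:Z)%:P) ^+ r l %| P l - P l.-1)%R).

Definition has_pieces (P : nat -> {poly R}) (u : R -> R) :=
  forall l x, (l < k)%N -> t l%:Z <= x <= t l.+1%:Z -> u x = (P l).[x].

Definition ppspline d r u := exists P, piecewise d r P /\ has_pieces P u.

Lemma ppspline_subspace d r : subspace (ppspline d r).
Proof.
split.
  exists (fun=> 0); split; last by move=> l x _ _; rewrite horner0.
  by split=> l _; rewrite ?size_poly0 ?subrr ?dvdp0.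
move=> a u v [P [[Pd Pr] Pu]] [P' [[Pd' Pr'] Pv]].
exists (fun l => a *: P l + P' l); split; last first.
  by move=> l x lk xl; rewrite (Pu l)// (Pv l)// hornerD hornerZ.
split=> l lk.
  rewrite (leq_trans (size_polyD _ _))// geq_max Pd' // andbT.
  by rewrite (leq_trans (size_scale_leq _ _))// Pd.
by rewrite opprD addrACA -scalerBr dvdp_add ?Pr'// -mul_polyC dvdp_mull // Pr.
Qed.

(** The jump of a product is (jump) * (factor) + (factor) * (jump). *)
Lemma ppspline_mul d1 d2 r u v : ppspline d1 r u -> ppspline d2 r v ->
  ppspline (d1 + d2) r (fun x => u x * v x).
Proof.
move=> [P [[Pd Pr] Pu]] [P' [[Pd' Pr'] Pv]].
exists (fun l => P l * P' l); split; last first.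
  by move=> l x lk xl; rewrite (Pu l)// (Pv l)// hornerM.
split=> l lk.
  rewrite (leq_trans (size_polyMleq _ _))//.
  have := Pd l lk; have := Pd' l lk; move: (size _) (size _) => a b; lia.
have -> : P l * P' l - P l.-1 * P' l.-1
    = (P l - P l.-1) * P' l + P l.-1 * (P' l - P' l.-1) by ring.
by apply: dvdp_add; [apply: dvdp_mulr; exact: Pr | apply: dvdp_mull; exact: Pr'].
Qed.

Lemma in_range_piece x : (0 < k)%N -> t 0 <= x <= t k%:Z ->
  exists2 l, (l < k)%N & t l%:Z <= x <= t l.+1%:Z.
Proof.
elim: k => // n IHn _ /andP[x0 xn].
have [n0|n0] := posnP n; first by exists 0%N => //; rewrite n0 in xn *; rewrite x0.
have [xlt|xge] := leP (t n%:Z) x; first by exists n => //; rewrite xlt.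
by have [|l ln xl] := IHn n0; [rewrite x0 ltW | exists l => //; rewrite ltnW].
Qed.

Lemma trunc_pow_ppspline d r (j : int) q : (0 < q <= d)%N ->
  (forall l : nat, (0 < l < k)%N -> j = l%:Z -> (r l <= q)%N) ->
  ppspline d r (fun x => trunc_pow q x (t j)).
Proof.
move=> /andP[q0 qd] rq.
exists (fun l => if l%:Z < j then (-1) ^+ q *: ('X - (t j)%:P) ^+ q else 0); split.
  split=> l lk.
    case: ifP => _; last by rewrite size_poly0.
    by rewrite (leq_trans (size_scale_leq _ _))// size_exp_XsubC.
  have [lj|lj] := eqVneq j l%:Z.
    rewrite lj ltxx (_ : l.-1%:Z < l%:Z); last by lia.
    by rewrite sub0r -scaleNr -mul_polyC dvdp_mull// dvdp_exp2l// rq.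
  by rewrite (_ : (l.-1%:Z < j) = (l%:Z < j)) ?subrr ?dvdp0//; lia.
move=> l x lk /andP[lx xl]; case: ifPn => lj.
  rewrite trunc_pow_poly; last by apply: le_trans xl _; apply: knot_le => //; lia.
  by rewrite hornerZ horner_exp hornerXsubC -exprMn mulN1r opprB.
rewrite horner0 trunc_pow_eq0//; apply: le_trans lx; apply: knot_le => //; lia.
Qed.

End PiecewisePolynomials.

Section SplinesArePiecewise.
Variables (R : realType) (m k : nat) (t : int -> R) (mu : int -> nat).
Hypothesis hk : (1 <= k)%N.
Hypothesis ht : forall i : int, t i < t (i + 1).
Hypothesis hmu : forall i : int, (1 <= mu i <= m)%N.

Definition smoothness (l : nat) := (m.+1 - mu l%:Z)%N.

Lemma active_Q_ppspline pq : ppspline k t m smoothness (@active_Q R m k t mu pq).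
Proof.
have CS := ppspline_subspace k t m smoothness.
case: pq => p q; rewrite /active_Q /=.
have [qmu|_] := ltnP q (mu (active_index p)); last exact: CS.1.
apply: Q_in => // j s jn sj; have mj := hmu (active_index p + j%:Z).
by apply: trunc_pow_ppspline => //; [lia | move=> q' _ E; rewrite /smoothness -E; lia].
Qed.

(** A piecewise polynomial is its first piece plus its jumps, truncated. A jump
    (X - t l)^r w, with r = m + 1 - mu l and w of degree less than m + mu l, is
    split as (X - t l)^m A + (X - t l)^r B with A and B of degree at most m, so
    that its truncation is a sum of two products of splines. *)
Lemma ppspline_in_products (G : (R -> R) -> Prop) : subspace G ->
  (forall u v, (forall x, t 0 <= x <= t k%:Z -> u x = v x) -> G u -> G v) ->
  (forall u v, real_spline m k t mu u -> real_spline m k t mu v ->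
     G (fun x => u x * v x)) ->
  forall u, ppspline k t (2 * m) smoothness u -> G u.
Proof.
move=> GS Geq GM.
have poly_split (p : {poly R}) (a : R) q n : (q <= n)%N -> (size p <= n)%N ->
    exists A B : {poly R}, [/\ p = A * ('X - a%:P) ^+ q + B,
      (size A <= n - q)%N & (size B <= q)%N].
  move=> qn pn; pose d := ('X - a%:P) ^+ q.
  have d0 : d != 0 by rewrite expf_neq0// polyXsubC_eq0.
  exists (p %/ d), (p %% d); split; first exact: divp_eq.
    by rewrite size_divp// size_exp_XsubC /= leq_sub2r.
  by have := ltn_modp p d; rewrite d0 size_exp_XsubC ltnS.
have Gmul (w : R -> R) (p : {poly R}) : real_spline m k t mu w -> (size p <= m.+1)%N ->
    G (fun x => p.[x] * w x).
  move=> Sw pm; apply: GM => //; exact: polynomial_real_spline.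
have Gpoly (p : {poly R}) : (size p <= (2 * m).+1)%N -> G (fun x => p.[x]).
  move=> /(@poly_split _ 0 m)[|A [B [-> sA sB]]]; first by lia.
  have GA : G (fun x => A.[x] * (('X - 0%:P) ^+ m : {poly R}).[x]).
    apply: Gmul; last by rewrite (leq_trans sA)//; lia.
    by apply: polynomial_real_spline => //; rewrite size_exp_XsubC.
  have GB : G (fun x => B.[x] * (1%:P : {poly R}).[x]).
    apply: Gmul; last by rewrite (leq_trans sB).
    by apply: polynomial_real_spline => //; rewrite size_polyC (leq_trans (leq_b1 _)).
  have := subspaceD GS GA GB; congr G; apply/funext => x.
  by rewrite hornerC mulr1 hornerD hornerM.
have Gjump l (w : {poly R}) : (0 < l < k)%N ->
    (size (('X - (t l%:Z)%:P) ^+ smoothness l * w)%R <= (2 * m).+1)%N ->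
    G (fun x => if t l%:Z < x then (('X - (t l%:Z)%:P) ^+ smoothness l * w).[x] else 0).
  move=> lk sdw; have ml := hmu l%:Z.
  have sw : (size w <= m + mu l%:Z)%N.
    have [->|w0] := eqVneq w 0; first by rewrite size_poly0.
    move: sdw; rewrite size_mul ?expf_neq0 ?polyXsubC_eq0// size_exp_XsubC /smoothness.
    move: (size w) => n; lia.
  move: sw => /(@poly_split _ (t l%:Z) (m - smoothness l)%N)[|A [B [-> sA sB]]].
    by rewrite /smoothness; lia.
  have GA : G (fun x => A.[x] * Num.max (x - t l%:Z) 0 ^+ m).
    apply: Gmul; last by rewrite (leq_trans sA)// /smoothness; lia.
    by apply: right_trunc_pow_real_spline => //; lia.
  have GB : G (fun x => B.[x] * Num.max (x - t l%:Z) 0 ^+ smoothness l).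
    apply: Gmul; last by rewrite (leq_trans sB)// /smoothness; lia.
    by apply: right_trunc_pow_real_spline => //; rewrite /smoothness; lia.
  have := subspaceD GS GA GB; congr G; apply/funext => x.
  have r0 : (0 < smoothness l)%N by rewrite /smoothness; lia.
  case: ltP => xl; last first.
    by rewrite max_r ?subr_le0// !expr0n !gtn_eqF ?mulr0 ?addr0//; lia.
  rewrite max_l ?subr_ge0 ?ltW// mulrDr hornerD !hornerM !horner_exp !hornerXsubC.
  rewrite mulrCA -exprD subnKC; last by rewrite /smoothness; lia.
  by congr (_ + _); rewrite mulrC.
move=> u [P [[Pd Pr] Pu]].
have GP : G (fun x => (P 0%N).[x] + \sum_(1 <= l < k)
    (if t l%:Z < x then (P l - P l.-1).[x] else 0)).
  apply: subspaceD => //; first by apply: Gpoly; apply: Pd.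
  rewrite (_ : (fun x => \sum_(1 <= l < k) _) =
    fun x => \sum_(l <- index_iota 1 k | (0 < l < k)%N)
      (if t l%:Z < x then (P l - P l.-1).[x] else 0)); last first.
    by apply/funext => x; rewrite big_nat.
  apply: subspace_sum => // l lk.
  have /dvdpP[w wE] := Pr l lk; rewrite wE mulrC; apply: Gjump => //.
  rewrite mulrC -wE (leq_trans (size_polyD _ _))// size_polyN geq_max !Pd//; lia.
apply: Geq GP => x xI.
have [l lk xl] := in_range_piece hk xI; rewrite (Pu l)//.
rewrite (big_cat_nat _ (n := l.+1))//= [X in _ + (_ + X)]big_nat_cond.
rewrite [X in _ + (_ + X)]big1 ?addr0 => [|j]; last first.
  rewrite andbT => /andP[lj _]; case: ltP => // jx; case/andP: xl => _ xl.
  by have := lt_le_trans jx xl; rewrite ltNge knot_le//; lia.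
rewrite (eq_big_nat _ _ (F2 := fun j => (P j).[x] - (P j.-1).[x])) => [|j /andP[j1 jl]].
  rewrite big_add1 telescope_sumr//; ring.
rewrite hornerD hornerN; case: ltP => // xj.
have jx : x = t j%:Z.
  apply/le_anti; rewrite xj; case/andP: xl => lx _.
  by rewrite (le_trans _ lx)// knot_le//; lia.
have /Pr : (0 < j < k)%N by lia.
rewrite -jx => jd; have r0 : (0 < smoothness j)%N.
  by rewrite /smoothness; have := hmu j%:Z; lia.
have : (P j - P j.-1).[x] = 0.
  by apply: (@dvdp_XsubC_exp_horner _ _ _ (smoothness j).-1); rewrite prednK.
by rewrite hornerD hornerN => ->.
Qed.

End SplinesArePiecewise.

(** * Complex splines *)

Section ComplexSplines.
Variables (R : realType) (m k : nat) (t : int -> R) (mu : int -> nat).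
Hypothesis ht : forall i : int, t i < t (i + 1).
Hypothesis hmu : forall i : int, (1 <= mu i <= m)%N.
Local Open Scope complex_scope.

Local Notation Qact := (@active_Q R m k t mu).

(** On [t 0, t k] the locally finite sum is a finite sum with fixed indices. *)
Lemma spline_sum_active (c : int -> nat -> R[i]) x : in_range k t x ->
  \sum_(i \in [set: int]) \sum_(1 <= l < (mu i).+1) c i l * (Q m t mu i l x)%:C
    = \sum_(pq : 'I_(k + m.+1) * 'I_m) c (active_index pq.1) pq.2.+1 * (Qact pq x)%:C.
Proof.
move=> xI.
pose r := [seq @active_index m k p | p <- enum 'I_(k + m.+1)].
have inj_index : injective (@active_index m k).
  by move=> p q; rewrite /active_index => /addIr[] pq; apply: val_inj.
have ur : uniq r by rewrite map_inj_uniq// enum_uniq.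
have -> : [set: int]%classic = [set` (xpredT : pred int)]%classic.
  by apply/seteqP; split.
rewrite -(bigfs _ ur) => [|i _ ir]; last first.
  rewrite big_nat big1// => l hl.
  rewrite (@Q_inactive R m k t mu) ?mulr0//.
  apply: contraNT ir => act; have [|p <-] := @active_indexP m k i; first by lia.
  by rewrite map_f// mem_enum.
rewrite big_map big_enum /= -(pair_bigA _ (fun (p : 'I_(k + m.+1)) (q : 'I_m) =>
  c (active_index p) q.+1 * (Qact (p, q) x)%:C)) /=.
apply: eq_bigr => p _; have mu_m : (mu (active_index p) <= m)%N.
  by case/andP: (hmu (active_index p)).
rewrite big_add1 /= big_mkord (big_ord_widen m (fun q =>
  c (active_index p) q.+1 * (Q m t mu (active_index p) q.+1 x)%:C) mu_m).
rewrite big_mkcond /=; apply: eq_bigr => q _; rewrite /active_Q /=.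
by case: ifP => _; rewrite ?mulr0.
Qed.

Lemma spline_space_real (f : R -> R[i]) : spline_space m t mu f ->
  exists u v, [/\ real_spline m k t mu u, real_spline m k t mu v &
    forall x, in_range k t x -> `|f x| ^+ 2 = (u x ^+ 2 + v x ^+ 2)%:C].
Proof.
move=> [c fc].
pose coef (pq : 'I_(k + m.+1) * 'I_m) := c (active_index pq.1) pq.2.+1.
have ReD (a b : R[i]) : complex.Re (a + b) = complex.Re a + complex.Re b.
  by case: a b => [? ?] [? ?].
have ImD (a b : R[i]) : complex.Im (a + b) = complex.Im a + complex.Im b.
  by case: a b => [? ?] [? ?].
exists (fun x => complex.Re (f x)), (fun x => complex.Im (f x)); split.
- exists (fun pq => complex.Re (coef pq)) => x xI.
  rewrite fc spline_sum_active// (big_morph _ ReD (erefl _)).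
  apply: eq_bigr => pq _; rewrite /coef; case: (c _ _) => a b /=.
  by rewrite mulr0 subr0.
- exists (fun pq => complex.Im (coef pq)) => x xI.
  rewrite fc spline_sum_active// (big_morph _ ImD (erefl _)).
  apply: eq_bigr => pq _; rewrite /coef; case: (c _ _) => a b /=.
  by rewrite mulr0 add0r.
- by move=> x xI; rewrite add_Re2_Im2.
Qed.

Lemma real_spline_extend (u : R -> R) : real_spline m k t mu u ->
  exists2 f, spline_space m t mu f & forall x, in_range k t x -> f x = (u x)%:C.
Proof.
move=> [d ud].
pose dq i l :=
  if [pick pq : 'I_(k + m.+1) * 'I_m | (active_index pq.1 == i) && (pq.2.+1 == l)]
  is Some pq then (d pq)%:C else 0.
exists (fun x => \sum_(i \in [set: int])
   \sum_(1 <= l < (mu i).+1) dq i l * (Q m t mu i l x)%:C); first by exists dq.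
move=> x xI; rewrite spline_sum_active// ud// rmorph_sum /=.
apply: eq_bigr => pq _; rewrite rmorphM /=; congr (_ * _).
rewrite /dq; case: pickP => [pq' /andP[/eqP p1 /eqP[p2]]|/(_ pq)]; last by rewrite !eqxx.
congr (d _)%:C; case: pq pq' p1 p2 => [p q] [p' q'] /=.
by rewrite /active_index => /addIr[] pE qE; congr pair; apply: val_inj.
Qed.

End ComplexSplines.

(** * Necessity: counting free coefficients *)

Lemma nonzero_solution (F : fieldType) (T : finType) (n : nat) (A : 'I_n -> T -> F) :
  (n < #|T|)%N ->
  exists c : T -> F, (exists s, c s != 0) /\ forall i, \sum_s c s * A i s = 0.
Proof.
move=> nT; pose M : 'M[F]_(#|T|, n) := \matrix_(a, b) A b (enum_val a).
have kerN0 : kermx M != 0.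
  rewrite kermx_eq0; apply/negP => /eqP rM.
  by have := rank_leq_col M; rewrite rM leqNgt nT.
pose v := nz_row (kermx M).
have vM : v *m M = 0 by apply/sub_kermxP; apply: nz_row_sub.
have /rV0Pn[a va] : v != 0 by rewrite nz_row_eq0.
exists (fun s => v 0 (enum_rank s)); split; first by exists (enum_val a); rewrite enum_valK.
move=> i; have := congr1 (fun B : 'M[F]_(1, n) => B 0 i) vM; rewrite !mxE => E.
rewrite -[RHS]E.
rewrite [RHS](reindex (@enum_rank T)) /=; last by apply: onW_bij; apply: enum_rank_bij.
by apply: eq_bigr => s _; rewrite mxE enum_rankK.
Qed.

Lemma poly_eq0_itv (R : rcfType) (p : {poly R}) (a b : R) : a < b ->
  (forall x, a <= x <= b -> p.[x] = 0) -> p = 0.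
Proof.
move=> ab px; apply/eqP; apply: contraT => p0.
have [y yn] := neighpr_wit ab p0.
have := neighpr_root yn; rewrite rootE px ?eqxx//.
move: yn; rewrite /neighpr in_itv /= => /andP[ay yn]; rewrite (ltW ay) /=.
have := next_root_in p a b; rewrite in_itv /= (max_l (ltW ab)) => /andP[_ nb].
by rewrite (le_trans (ltW yn)).
Qed.

Section Necessity.
Variables (R : realType) (m k : nat) (t : int -> R) (mu : int -> nat).
Hypothesis hk : (1 <= k)%N.
Hypothesis ht : forall i : int, t i < t (i + 1).
Hypothesis hmu : forall i : int, (1 <= mu i <= m)%N.
Variables (K : nat) (E : K.-tuple R).
Hypothesis E_sub : forall x, x \in (E : seq R) -> x \in `[t 0, t k%:Z].
Hypothesis sampling : linear_sampling (t 0) (t k%:Z)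
  (squared_modulus_on (spline_space m t mu) (t 0) (t k%:Z)) E.

(** The sampling formula is linear in h, so it extends from squares to products by
    polarization, and then to all smooth piecewise polynomials of degree 2m. *)
Lemma sampling_determines u : ppspline k t (2 * m) (smoothness m mu) u ->
  (forall x, x \in (E : seq R) -> u x = 0) ->
  forall x, t 0 <= x <= t k%:Z -> u x = 0.
Proof.
move=> uP uE; have [S hS] := sampling.
pose G v := forall x, t 0 <= x <= t k%:Z ->
  (v x)%:C%C = \sum_(n < K) (v (tnth E n))%:C%C * S n x.
have EI n : t 0 <= tnth E n <= t k%:Z.
  by have := E_sub (mem_tnth n E); rewrite in_itv.
have GS : subspace G.
  split=> [x _|a v w Gv Gw x xI].
    by rewrite rmorph0 big1// => n _; rewrite mul0r.
  rewrite rmorphD rmorphM /= Gv// Gw// mulr_sumr -big_split /=.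
  by apply: eq_bigr => n _; rewrite rmorphD rmorphM /= mulrDl mulrA.
have Geq v w : (forall x, t 0 <= x <= t k%:Z -> v x = w x) -> G v -> G w.
  by move=> vw Gv x xI; rewrite -vw// Gv//; apply: eq_bigr => n _; rewrite vw.
have Gsqr v : real_spline m k t mu v -> G (fun x => v x ^+ 2).
  move=> /(real_spline_extend ht hmu)[f Wf fv] x xI.
  have hE z : t 0 <= z <= t k%:Z -> patch (cst 0) `[t 0, t k%:Z]%classic
      (fun x => `|f x| ^+ 2) z = (v z ^+ 2)%:C%C.
    move=> zI; rewrite /patch ifT; last by rewrite inE /= in_itv.
    by rewrite fv// -add_Re2_Im2 /= expr0n addr0.
  rewrite -hE// (hS (patch (cst 0) `[t 0, t k%:Z]%classic (fun x => `|f x| ^+ 2))).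
  - by apply: eq_bigr => n _; rewrite hE.
  - by exists f.
  - by rewrite in_itv.
have GM v w : real_spline m k t mu v -> real_spline m k t mu w -> G (fun x => v x * w x).
  move=> Sv Sw; have CS := real_spline_subspace m k t mu.
  have := subspaceZ GS (4%:R^-1) (subspaceB GS (Gsqr _ (subspaceD CS Sv Sw))
                                               (Gsqr _ (subspaceB CS Sv Sw))).
  by congr G; apply/funext => x; field.
have Gu := ppspline_in_products hk ht hmu GS Geq GM uP.
move=> x xI; have := Gu x xI; rewrite big1 => [|n _]; last by rewrite uE ?mem_tnth// mul0r.
by case.
Qed.

(** [N l] is the number of free coefficients of the jump at t l. If the unknowns
    outnumber the equations, which are the values at the points of E satisfying
    [I] and the 2m + 1 coefficients of the sum of all jumps, some nonzero choice of
    jumps solves them. At the remaining points of E it vanishes as well: they lie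
    to the left or to the right of all knots that are used. The value 2m + 1 of
    [N 0] or [N k] stands for a piece that is free at that end of the interval. *)
Lemma sampling_count (N : nat -> nat) (I : pred R) :
  (forall l, (l <= k)%N -> (N l <= (2 * m).+1)%N) ->
  (forall l, (0 < l < k)%N -> (N l <= m + mu l%:Z)%N) ->
  (forall x, x \in (E : seq R) -> ~~ I x ->
     (forall l, (l <= k)%N -> (0 < N l)%N ->
        x <= t l%:Z /\ (l = 0%N -> (N l <= 2 * m)%N)) \/
     (forall l, (l <= k)%N -> (0 < N l)%N ->
        t l%:Z <= x /\ (l <> 0%N -> (N l <= 2 * m)%N))) ->
  (\sum_(0 <= l < k.+1) N l <= count I E + (2 * m).+1)%N.
Proof.
move=> Nle Nin NI; rewrite leqNgt; apply/negP => big.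
pose T := {l : 'I_k.+1 & 'I_(N l)}.
have cardT : #|{: T}| = (\sum_(0 <= l < k.+1) N l)%N.
  rewrite card_tagged sumnE big_map big_enum /= big_mkord.
  by apply: eq_bigr => l _; rewrite card_ord.
pose bas (s : T) : {poly R} :=
  ('X - (t (tag s)%:Z)%:P) ^+ ((2 * m).+1 - N (tag s)) * 'X^(tagged s).
(* The contribution of one jump coefficient to the value at x. The inequality
     is strict because the value at t k must be that of the last piece, to the
     left of the jump at t k; a jump at t 0 is always present. *)
pose phi (s : T) x :=
  if (tag s == 0%N :> nat) || (t (tag s)%:Z < x) then (bas s).[x] else 0.
pose pts := [seq x <- E | I x].
pose A (i : 'I_((2 * m).+1 + size pts)) (s : T) : R :=
  if (i < (2 * m).+1)%N then (bas s)`_i else phi s (nth 0 pts (i - (2 * m).+1)).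
have [|c [[s0 cs0] cA]] := @nonzero_solution _ _ _ A.
  by rewrite cardT size_filter addnC.
pose P l : {poly R} := \sum_(s : T | (tag s <= l)%N) c s *: bas s.
pose u x := \sum_s c s * phi s x.
have Ntag (s : T) : (N (tag s) <= (2 * m).+1)%N by apply: Nle; rewrite -ltnS.
have size_bas s : (size (bas s) <= (2 * m).+1)%N.
  rewrite size_mul ?expf_neq0 ?polyXsubC_eq0 ?polyX_eq0// size_exp_XsubC size_polyXn.
  by have := ltn_ord (tagged s); have := Ntag s; lia.
have bas_root (s : T) : (N (tag s) <= 2 * m)%N -> (bas s).[t (tag s)%:Z] = 0.
  move=> Ns; rewrite hornerM horner_exp hornerXsubC subrr expr0n gtn_eqF ?mul0r//.
  by rewrite subn_gt0.
have size_P l : (size (P l) <= (2 * m).+1)%N.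
  apply: (leq_trans (size_sum _ _ _)); apply/bigmax_leqP => s _.
  exact: leq_trans (size_scale_leq _ _) (size_bas s).
have inner_N l : (0 < l < k)%N -> (N l <= 2 * m)%N.
  by move=> lk; have := Nin l lk; have := hmu l%:Z; lia.
have pieces l x : (l < k)%N -> t l%:Z <= x <= t l.+1%:Z -> u x = (P l).[x].
  move=> lk /andP[lx xl]; rewrite horner_sum big_mkcond /=; apply: eq_bigr => s _.
  rewrite hornerZ /phi; have [sl|ls] := leqP (tag s) l; last first.
    rewrite gtn_eqF ?(leq_ltn_trans _ ls)//= ifF ?mulr0//.
    by apply/negbTE; rewrite -leNgt (le_trans xl)// knot_le.
  have [//|s0'] := eqVneq (tag s : nat) 0%N; case: ltP => //= xs.
  have xE : x = t (tag s)%:Z.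
    by apply/le_anti; rewrite xs (le_trans _ lx)// knot_le.
  by rewrite xE bas_root ?mulr0// inner_N// lt0n s0' (leq_ltn_trans sl).
(* The sum of all jumps is the polynomial to the right of t k. *)
have Pk : P k = 0.
  apply/polyP => e; rewrite coef0.
  have [em|em] := ltnP e (2 * m).+1; last by rewrite nth_default// (leq_trans (size_P k)).
  have ei : (e < (2 * m).+1 + size pts)%N by rewrite ltn_addr.
  have := cA (Ordinal ei); rewrite /A /= em => sol; rewrite -[RHS]sol.
  rewrite coef_sum; apply: eq_big => [s|s _]; last by rewrite coefZ.
  by rewrite -ltnS ltn_ord.
have uE x : x \in (E : seq R) -> u x = 0.
  move=> xE; have [Ix|Ix] := boolP (I x).
    have xp : x \in pts by rewrite mem_filter Ix.
    have ei : ((2 * m).+1 + index x pts < (2 * m).+1 + size pts)%N.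
      by rewrite ltn_add2l index_mem.
    have := cA (Ordinal ei); rewrite /A /= ltnNge leq_addr /= addKn nth_index//.
  have /andP[x0 xk] : t 0 <= x <= t k%:Z by have := E_sub xE; rewrite in_itv.
  have tag_le (s : T) : (tag s <= k)%N by rewrite -ltnS.
  have N_gt0 (s : T) : (0 < N (tag s))%N by apply: leq_ltn_trans (ltn_ord (tagged s)).
  case: (NI x xE Ix) => side.
    rewrite /u big1// => s _; have [xs sN] := side _ (tag_le s) (N_gt0 s).
    rewrite /phi ltNge xs orbF; case: eqP => [s0'|_]; last by rewrite mulr0.
    have -> : x = t (tag s)%:Z by apply/le_anti; rewrite xs s0' x0.
    by rewrite bas_root ?mulr0// sN.
  have -> : u x = (P k).[x]; last by rewrite Pk horner0.
  rewrite horner_sum; apply: eq_big => [s|s _]; first by rewrite tag_le.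
  have [sx sN] := side _ (tag_le s) (N_gt0 s).
  rewrite hornerZ /phi; case: eqP => //= s0'; case: ltP => // xs.
  have -> : x = t (tag s)%:Z by apply/le_anti; rewrite xs sx.
  by rewrite bas_root// sN.
have uP : ppspline k t (2 * m) (smoothness m mu) u.
  exists P; split; last exact: pieces.
  split=> l lk; first exact: size_P.
  have PE j : P j = \sum_(s : T) (if (tag s <= j)%N then c s *: bas s else 0).
    by rewrite /P big_mkcond.
  rewrite !PE -sumrB.
  apply: (big_ind (fun p : {poly R} =>
    is_true (('X - (t l%:Z)%:P) ^+ smoothness m mu l %| p)%R)) => [||s _].
  - exact: dvdp0.
  - by move=> p q; apply: dvdp_add.
  have [sl|sl] := eqVneq (tag s : nat) l; last first.
    by rewrite (_ : (tag s <= l.-1)%N = (tag s <= l)%N) ?subrr ?dvdp0//; lia.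
  rewrite sl leqnn ifF ?subr0; last by lia.
  rewrite -mul_polyC dvdp_mull// /bas dvdp_mulr// sl dvdp_exp2l//.
  by have := Nin l lk; have := hmu l%:Z; rewrite /smoothness; lia.
have u0 := sampling_determines uP uE.
have P0 l : (l <= k)%N -> P l = 0.
  rewrite leq_eqVlt => /predU1P[->//|lk].
  apply: (@poly_eq0_itv _ _ (t l%:Z) (t l.+1%:Z)); first by apply: (knot_lt ht); lia.
  move=> x /andP[lx xl]; rewrite -(pieces l x lk) ?lx// u0//.
  by rewrite (le_trans _ lx) ?(le_trans xl) ?knot_le//; lia.
have q0 l : (l <= k)%N -> \sum_(s : T | tag s == l :> nat) c s *: bas s = 0.
  move=> lk; have [l0|l0] := posnP l.
    have := P0 0%N (leq0n k); rewrite /P l0; under eq_bigl do rewrite leqn0; done.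
  have : P l - P l.-1 = 0 by rewrite !P0 ?subrr//; lia.
  rewrite /P [X in X - _](bigID (fun s : T => (tag s <= l.-1)%N)) /=.
  rewrite [X in X + _ - _](eq_bigl (fun s : T => (tag s <= l.-1)%N)); last first.
    by move=> s /=; rewrite andb_idl// => /leq_trans; apply; exact: leq_pred.
  rewrite addrC addKr => jump0; rewrite -[RHS]jump0; apply: eq_bigl => s.
  by rewrite -ltnNge prednK// eqn_leq.
have tag_k : (tag s0 <= k)%N by rewrite -ltnS.
have := q0 _ tag_k.
have -> : \sum_(s : T | tag s == tag s0 :> nat) c s *: bas s
  = ('X - (t (tag s0)%:Z)%:P) ^+ ((2 * m).+1 - N (tag s0))
    * \sum_(s : T | tag s == tag s0 :> nat) c s *: 'X^(tagged s).
  rewrite mulr_sumr; apply: eq_bigr => s /eqP sE.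
  by rewrite /bas scalerAr; congr (_ * _); rewrite sE.
move=> /eqP; rewrite mulf_eq0 expf_eq0 polyXsubC_eq0 andbF /= => /eqP/polyP/(_ (tagged s0)).
rewrite coef0 coef_sum (bigD1 s0)//= coefZ coefXn eqxx mulr1 big1 ?addr0.
  by move/eqP; rewrite (negPf cs0).
move=> s /andP[/eqP sE ss0]; rewrite coefZ coefXn.
case: eqP => [vE|_]; last by rewrite mulr0.
case/eqP: ss0; case: s s0 sE vE {cs0 tag_k} => [l j] [l' j'] /= /val_inj lE.
rewrite lE in j *.
by move=> /val_inj->.
Qed.

End Necessity.

(** * Sufficiency: counting zeros *)

Lemma maximal_run_left (Z : pred nat) a : Z a ->
  exists i, [/\ (i <= a)%N, forall l, (i <= l <= a)%N -> Z l & (0 < i)%N -> ~~ Z i.-1].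
Proof.
elim: a => [|a IHa] Za.
  by exists 0%N; split=> // l; rewrite leqn0 => /eqP->.
have [Za'|Za'] := boolP (Z a); last first.
  by exists a.+1; split=> // l; rewrite -eqn_leq => /eqP<-.
have [i [ia Zi iN]] := IHa Za'; exists i; split=> //; first exact: leqW.
move=> l /andP[il]; rewrite leq_eqVlt => /predU1P[->//|]; rewrite ltnS => la.
by apply: Zi; rewrite il.
Qed.

Lemma maximal_run_right (Z : pred nat) a k : (a < k)%N -> Z a ->
  exists j, [/\ (a < j <= k)%N, forall l, (a <= l < j)%N -> Z l & (j < k)%N -> ~~ Z j].
Proof.
elim: k => // k IHk; rewrite ltnS leq_eqVlt => /predU1P[->|ak] Za.
  exists k.+1; split; rewrite ?ltnn ?ltnSn// => l; rewrite ltnS -eqn_leq => /eqP <-//.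
have [j [/andP[aj jk] Zj jN]] := IHk ak Za.
have [jlt|jge] := ltnP j k; first by exists j; split=> [||_] //; rewrite ?aj ?leqW// jN.
have {jge} jE : j = k by apply/eqP; rewrite eqn_leq jk.
rewrite {j aj jk jN}jE in Zj.
have [Zk|Zk] := boolP (Z k); last first.
  by exists k; split=> //; rewrite ak leqnSn.
exists k.+1; split; rewrite ?ltnn ?leqnn ?andbT ?leqW// => l /andP[al].
by rewrite ltnS leq_eqVlt => /predU1P[->//|lk]; apply: Zj; rewrite al.
Qed.

Section CountIntervals.
Variables (R : realDomainType) (E : seq R) (a b : R).
Hypotheses (E_uniq : uniq E) (ab : a < b).

Lemma count_predU1 (c : R) (f g : pred R) : ~~ f c ->
  (forall x, g x = (x == c) || f x) -> count g E = ((c \in E) + count f E)%N.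
Proof.
move=> fc gE; rewrite (eq_count gE) -(count_uniq_mem _ E_uniq).
have := count_predUI (pred1 c) f E.
rewrite [X in (_ + X)%N](@eq_count _ _ pred0) ?count_pred0 ?addn0// => x /=.
by case: eqP => // ->; rewrite (negPf fc).
Qed.

Lemma count_itv_co : count (mem `[a, b[) E = ((a \in E) + count (mem `]a, b[) E)%N.
Proof.
apply: count_predU1; first by rewrite /= in_itv /= ltxx.
move=> x; rewrite /= !in_itv /=; have [->|xa] := eqVneq x a; first by rewrite lexx ab.
by rewrite le_eqVlt eq_sym (negPf xa).
Qed.

Lemma count_itv_oc : count (mem `]a, b]) E = ((b \in E) + count (mem `]a, b[) E)%N.
Proof.
apply: count_predU1; first by rewrite /= in_itv /= ltxx andbF.
move=> x; rewrite /= !in_itv /=; have [->|xb] := eqVneq x b; first by rewrite lexx ab.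
by rewrite [x <= b]le_eqVlt (negPf xb).
Qed.

Lemma count_itv_cc : count (mem `[a, b]) E
  = ((a \in E) + (b \in E) + count (mem `]a, b[) E)%N.
Proof.
rewrite -addnA -count_itv_oc; apply: count_predU1; first by rewrite /= in_itv /= ltxx.
move=> x; rewrite /= !in_itv /=; have [->|xa] := eqVneq x a; first by rewrite lexx ltW.
by rewrite [a <= x]le_eqVlt eq_sym (negPf xa).
Qed.

End CountIntervals.

Section Sufficiency.
Variables (R : realType) (m k : nat) (t : int -> R) (mu : int -> nat).
Hypothesis hk : (1 <= k)%N.
Hypothesis ht : forall i : int, t i < t (i + 1).
Hypothesis hmu : forall i : int, (1 <= mu i <= m)%N.
Variables (K : nat) (E : K.-tuple R).
Hypothesis E_uniq : uniq E.
Hypothesis E_sub : forall x, x \in (E : seq R) -> x \in `[t 0, t k%:Z].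

(** On a maximal run of nonzero pieces the spline joins zero pieces smoothly, or
    ends at t 0 or t k. In each of the four cases the corresponding inequality
    exceeds the bound of [spline_zeros] by one. *)
Lemma counts_determine u :
  (2 * m + 1 + \sum_(1 <= l < k) (m + mu l%:Z) <= K)%N ->
  (forall i : nat, (1 <= i <= k)%N ->
     (\sum_(1 <= l < i.+1) (m + mu l%:Z) <= num_points E `[t 0, t i%:Z[)%N) ->
  (forall i : nat, (i <= k - 1)%N ->
     (\sum_(i <= l < k) (m + mu l%:Z) <= num_points E `]t i%:Z, t k%:Z])%N) ->
  (forall i j : nat, (i < j <= k)%N ->
     (\sum_(i <= l < j.+1) (m + mu l%:Z)
        <= num_points E `]t i%:Z, t j%:Z[ + 2 * m + 1)%N) ->
  ppspline k t (2 * m) (smoothness m mu) u ->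
  (forall x, x \in (E : seq R) -> u x = 0) ->
  forall x, t 0 <= x <= t k%:Z -> u x = 0.
Proof.
move=> c1 c2 c3 c4 [P [[Pd Pr] Pu]] uE x xI.
have [l lk xl] := in_range_piece hk xI; rewrite (Pu l)//.
suff -> : P l = 0 by rewrite horner0.
apply/eqP; apply: contraT => Pl.
have [i [il Zi iN]] := maximal_run_left (Z := fun l => P l != 0) Pl.
have [j [/andP[lj jk] Zj jN]] := maximal_run_right lk (Z := fun l => P l != 0) Pl.
have ij : (i < j)%N by apply: leq_ltn_trans lj.
have j0 : (0 < j)%N := leq_ltn_trans (leq0n i) ij.
have ik : (i < k)%N := leq_trans ij jk.
have jk1 : (j.-1 < k)%N by rewrite prednK.
have Z l' : (i <= l' < j)%N -> P l' != 0.
  case/andP=> il' l'j; have [l'l|ll'] := leqP l' l.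
    by apply: Zi; rewrite il' l'l.
  by apply: Zj; rewrite (ltnW ll') l'j.
pose r := smoothness m mu.
have rE l' : (r l' + (m + mu l'%:Z) = (2 * m).+1)%N.
  by have := hmu l'%:Z; rewrite /r /smoothness; clear; lia.
have r0 l' : (0 < r l')%N by have := hmu l'%:Z; rewrite /r /smoothness; clear; lia.
pose tau (l' : nat) := t l'%:Z.
have tauS : {homo tau : a b / (a < b)%N >-> a < b}.
  by move=> a b ab; apply: (knot_lt ht); clear -ab; lia.
have zeros := @spline_zeros R (2 * m) tau r P E i j E_uniq tauS ij.
have {}zeros : (count (mem `]tau i, tau j[) E + min_var_left (2 * m).+1 (P j.-1) (tau j)
    <= min_var_right (2 * m).+1 (P i) (tau i) + \sum_(i.+1 <= l < j) (m + mu l%:Z))%N.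
  have -> : (\sum_(i.+1 <= l < j) (m + mu l%:Z)
      = \sum_(i.+1 <= l < j) ((2 * m).+1 - r l))%N.
    by apply: eq_bigr => l' _; rewrite -(rE l') addKn.
  apply: zeros.
  - move=> l' l'ij; split; first exact: Z.
    by apply: Pd; case/andP: l'ij => _ /leq_trans; apply.
  - move=> l' /andP[il' l'j]; split; first exact: r0.
    by apply: Pr; rewrite (leq_ltn_trans _ il')// (leq_trans l'j).
  - move=> l' y /andP[_ l'j] yE yl'.
    by rewrite -(Pu l')// ?uE// (leq_trans l'j).
have root_dvd (q : {poly R}) a : q.[a] = 0 -> (('X - a%:P) ^+ 1 %| q)%R.
  by move=> qa; rewrite expr1 dvdp_XsubCl rootE qa.
have Pi0 : P i != 0 by apply: Z; rewrite leqnn.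
have Pj0 : P j.-1 != 0 by apply: Z; rewrite -ltnS prednK// ij leqnn.
have sPi : (size (P i) <= (2 * m).+1)%N by apply: Pd.
have sPj : (size (P j.-1) <= (2 * m).+1)%N by apply: Pd.
have left_end : (0 < i)%N -> (min_var_right (2 * m).+1 (P i) (tau i) + r i <= 2 * m)%N.
  move=> i0; apply: min_var_right_zeros => //.
  have -> : P i = P i - P i.-1 by have /negPn/eqP-> := iN i0; rewrite subr0.
  by apply: Pr; rewrite i0 ik.
(* At t 0 and t k a point of E is a zero of the first or last piece, and costs as
   much as smoothness of order 1. *)
have left_bd : i = 0%N ->
    (min_var_right (2 * m).+1 (P i) (tau i) + (tau 0%N \in E) <= 2 * m)%N.
  move=> i0; apply: min_var_right_zeros => //; rewrite i0.
  case: (boolP (tau 0%N \in E)) => tE; last by rewrite expr0 dvd1p.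
  by apply: root_dvd; rewrite -(Pu 0%N) ?uE// lexx ltW// tauS.
have right_end : (j < k)%N -> (r j <= min_var_left (2 * m).+1 (P j.-1) (tau j))%N.
  move=> jk'; apply: min_var_left_zeros => //.
  have := Pr j; rewrite jk' andbT j0 => /(_ isT).
  by have /negPn/eqP-> := jN jk'; rewrite sub0r dvdpNr.
have right_bd : j = k -> ((tau k \in E) <= min_var_left (2 * m).+1 (P j.-1) (tau j))%N.
  move=> jE; apply: min_var_left_zeros => //; rewrite jE.
  case: (boolP (tau k \in E)) => tE; last by rewrite expr0 dvd1p.
  have k1 : (k.-1 < k)%N by rewrite prednK.
  apply: root_dvd; rewrite -(Pu k.-1) ?uE// prednK// lexx andbT.
  by apply: ltW; apply: tauS.
have sum_j : (\sum_(i.+1 <= l < j.+1) (m + mu l%:Z)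
    = \sum_(i.+1 <= l < j) (m + mu l%:Z) + (m + mu j%:Z))%N by rewrite big_nat_recr.
have sum_i : (\sum_(i <= l < j) (m + mu l%:Z)
    = (m + mu i%:Z) + \sum_(i.+1 <= l < j) (m + mu l%:Z))%N by rewrite big_ltn.
have sum_ij : (\sum_(i <= l < j.+1) (m + mu l%:Z)
    = (m + mu i%:Z) + \sum_(i.+1 <= l < j.+1) (m + mu l%:Z))%N.
  by rewrite big_ltn// ltnS ltnW.
have ri := rE i; have rj := rE j.
have tij := tauS i j ij.
rewrite /num_points in c2 c3 c4.
have [i0|i0] := posnP i; have [jk'|jk'] := leqP k j.
- have jE : j = k by apply/eqP; rewrite eqn_leq jk jk'.
  have := left_bd i0; have := right_bd jE.
  have := count_itv_cc E_uniq tij.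
  have -> : count (mem `[tau i, tau j]) E = K.
    rewrite -[RHS](size_tuple E); apply/eqP; rewrite -all_count; apply/allP => y yE.
    by have := E_sub yE; rewrite i0 jE.
  move: c1 zeros; rewrite i0 jE; move: (nat_of_bool _) (nat_of_bool _) (count _ _) => A B C.
  move: (min_var_right _ _ _) (min_var_left _ _ _) (\sum_(1 <= l < k) _)%N => D F G.
  clear -ri rj; lia.
- have := left_bd i0; have := right_end jk'.
  have := count_itv_co E_uniq tij.
  have := c2 j; rewrite jk andbT (leq_ltn_trans _ ij)// => /(_ isT).
  move: zeros sum_j; rewrite i0 => zeros ->; rewrite -/(tau j) -[t 0]/(tau 0%N).
  move: zeros; move: (nat_of_bool _) (count _ _) (count _ _) => A B C.
  move: (min_var_right _ _ _) (min_var_left _ _ _) (\sum_(1 <= l < j) _)%N => D F G.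
  clear -ri rj; lia.
- have jE : j = k by apply/eqP; rewrite eqn_leq jk jk'.
  have := left_end i0; have := right_bd jE.
  have := count_itv_oc E_uniq tij.
  have := c3 i; rewrite subn1 -ltnS prednK// => /(_ ik).
  move: zeros sum_i; rewrite jE => zeros ->; rewrite -/(tau k) -/(tau i).
  move: zeros; move: (nat_of_bool _) (count _ _) (count _ _) => A B C.
  move: (min_var_right _ _ _) (min_var_left _ _ _) (\sum_(i.+1 <= l < k) _)%N => D F G.
  clear -ri rj; lia.
have := left_end i0; have := right_end jk'.
have := c4 i j; rewrite ij jk => /(_ isT).
rewrite sum_ij sum_j -/(tau i) -/(tau j).
move: zeros; move: (count _ _) => A.
move: (min_var_right _ _ _) (min_var_left _ _ _) (\sum_(i.+1 <= l < j) _)%N => D F G.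
  clear -ri rj; lia.
Qed.

(** The vector of all products of two B-splines at x lies in the row space of
    their matrix of values on E, since a combination that vanishes on E vanishes
    at x. The coordinates in this row space are the functions S_n. *)
Lemma sampling_of_determined :
  (forall u, ppspline k t (2 * m) (smoothness m mu) u ->
     (forall x, x \in (E : seq R) -> u x = 0) ->
     forall x, t 0 <= x <= t k%:Z -> u x = 0) ->
  linear_sampling (t 0) (t k%:Z)
    (squared_modulus_on (spline_space m t mu) (t 0) (t k%:Z)) E.
Proof.
move=> det.
pose J := ('I_(k + m.+1) * 'I_m)%type.
pose Phi (s : J * J) x := active_Q t mu s.1 x * active_Q t mu s.2 x.
pose B : 'M[R]_(K, #|{: J * J}|) := \matrix_(n, a) Phi (enum_val a) (tnth E n).
pose PhiV x : 'rV[R]_#|{: J * J}| := \row_a Phi (enum_val a) x.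
pose S x := PhiV x *m pinvmx B.
have PhiB x : t 0 <= x <= t k%:Z -> S x *m B = PhiV x.
  move=> xI; apply: mulmxKpV; rewrite submxE; apply/eqP/rowP => b; rewrite !mxE.
  pose u y := \sum_a cokermx B a b * Phi (enum_val a) y.
  have uP : ppspline k t (2 * m) (smoothness m mu) u.
    have CS := ppspline_subspace k t (2 * m) (smoothness m mu).
    apply: subspace_sum => // a _; apply: subspaceZ => //.
    by rewrite mul2n -addnn; apply: ppspline_mul; apply: active_Q_ppspline.
  transitivity (u x); first by apply: eq_bigr => a _; rewrite mxE mulrC.
  apply: det => // _ /tnthP[n ->].
  have := congr1 (fun M : 'M[R]_(K, _) => M n b) (mulmx_coker B); rewrite !mxE => Bn.
  by rewrite -[RHS]Bn; apply: eq_bigr => a _; rewrite !mxE mulrC.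
exists (fun n x => (S x 0 n)%:C%C) => h [f Wf <-] x; rewrite in_itv /= => xI.
have [u [v [[c cu] [d dv] fuv]]] := spline_space_real k ht hmu Wf.
have hE y : t 0 <= y <= t k%:Z ->
    patch (cst 0) `[t 0, t k%:Z]%classic (fun x => `|f x| ^+ 2) y
    = (\sum_(s : J * J) (c s.1 * c s.2 + d s.1 * d s.2) * Phi s y)%:C%C.
  move=> yI; rewrite /patch ifT; last by rewrite inE /= in_itv.
  rewrite fuv// cu// dv// !expr2 !big_distrlr /= !pair_bigA -big_split /=.
  congr (_%:C)%C; apply: eq_bigr => s _; rewrite /Phi; ring.
rewrite hE//.
under eq_bigr => n _.
  rewrite hE; last by have := E_sub (mem_tnth n E); rewrite in_itv.
  rewrite -rmorphM; over.
rewrite -rmorph_sum /=; congr (_%:C)%C.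
under [RHS]eq_bigr => n _ do rewrite mulr_suml.
rewrite exchange_big /=; apply: eq_bigr => s _.
have := congr1 (fun M : 'rV[R]__ => M 0 (enum_rank s)) (PhiB x xI).
rewrite !mxE enum_rankK => <-; rewrite mulr_sumr; apply: eq_bigr => n _.
by rewrite !mxE enum_rankK mulrA [in RHS]mulrAC.
Qed.

End Sufficiency.

(** * The sampling theorem *)

Lemma sum_nat_restrict (a b n : nat) (F : nat -> nat) : (b <= n)%N ->
  (\sum_(0 <= l < n) (if (a <= l < b)%N then F l else 0) = \sum_(a <= l < b) F l)%N.
Proof.
move=> bn; rewrite -big_mkcond /= [RHS](big_nat_widenl _ 0)//.
by rewrite [RHS](big_nat_widen _ _ n)//; apply: eq_bigl.
Qed.

Theorem theorem3p1 (R : realType) (m k : nat) (hm : (1 <= m)%N)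
    (hk : (1 <= k)%N) (t : int -> R) (ht : forall i : int, t i < t (i + 1))
    (mu : int -> nat) (hmu : forall i : int, (1 <= mu i <= m)%N)
    (K : nat) (E : K.-tuple R) (E_uniq : uniq E)
    (E_sub : forall x, x \in (E : seq R) -> x \in `[t 0, t k%:Z]) :
  linear_sampling (t 0) (t k%:Z)
    (squared_modulus_on (spline_space m t mu) (t 0) (t k%:Z)) E
  <->
  [/\ (2 * m + 1 + \sum_(1 <= l < k) (m + mu l%:Z) <= K)%N,
      forall i : nat, (1 <= i <= k)%N ->
        (\sum_(1 <= l < i.+1) (m + mu l%:Z)
           <= num_points E `[t 0, t i%:Z[)%N,
      forall i : nat, (i <= k - 1)%N ->
        (\sum_(i <= l < k) (m + mu l%:Z)
           <= num_points E `]t i%:Z, t k%:Z])%N &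
      forall i j : nat, (i < j <= k)%N ->
        (\sum_(i <= l < j.+1) (m + mu l%:Z)
           <= num_points E `]t i%:Z, t j%:Z[ + 2 * m + 1)%N].
Proof.
split=> [sampling|[c1 c2 c3 c4]]; last first.
  by apply: sampling_of_determined => // u; apply: counts_determine.
have count_bound := sampling_count hk ht hmu E_sub sampling.
have mu_le (l : nat) : (m + mu l%:Z <= 2 * m)%N.
  by rewrite mul2n -addnn leq_add2l; case/andP: (hmu l%:Z).
have mu_leS (l : nat) : (m + mu l%:Z <= (2 * m).+1)%N by rewrite leqW.
have t_le (a b : nat) : (a <= b)%N -> t a%:Z <= t b%:Z.
  by move=> ab; apply: knot_le.
have in_E x : x \in (E : seq R) -> t 0 <= x /\ x <= t k%:Z.
  by move=> /E_sub; rewrite in_itv => /andP.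
pose support (I : pred nat) l := if I l then (m + mu l%:Z)%N else 0%N.
split=> [|i /andP[i1 ik]|i ik|i j /andP[ij jk]].
(* Both end pieces are free. *)
- pose N l := if (l == 0%N) || (l == k) then (2 * m).+1 else (m + mu l%:Z)%N.
  have N_inner l : (0 < l < k)%N -> N l = (m + mu l%:Z)%N.
    by move=> /andP[l0 lk]; rewrite /N gtn_eqF// ltn_eqF.
  have Nk : N k = (2 * m).+1 by rewrite /N eqxx orbT.
  have := @count_bound N predT.
  rewrite count_predT size_tuple big_nat_recr//= big_ltn// Nk leq_add2r.
  rewrite (eq_big_nat _ _ N_inner) addn1; apply=> //.
    by move=> l _; rewrite /N; case: ifP.
  by move=> l lk; rewrite N_inner.
(* Free piece at the left end, zero to the right of t i. *)
- pose N l := if l == 0%N then (2 * m).+1 else support (fun l => (1 <= l < i.+1)%N) l.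
  have := @count_bound N (mem `[t 0, t i%:Z[).
  rewrite big_ltn// [N 0%N]/N /= addnC leq_add2r.
  have -> : (\sum_(1 <= l < k.+1) N l = \sum_(1 <= l < i.+1) (m + mu l%:Z))%N.
    rewrite -[RHS](@sum_nat_restrict 1 i.+1 k.+1)// [RHS]big_ltn// add0n.
    by apply: eq_big_nat => l /andP[l1 lk]; rewrite /N gtn_eqF.
  apply=> [l _|l /andP[l0 _]|x xE].
  + by rewrite /N /support; case: ifP => // _; case: ifP.
  + by rewrite /N /support gtn_eqF//; case: ifP.
  rewrite /= in_itv /= (in_E x xE).1 /= -leNgt => ix.
  right=> l lk; rewrite /N /support; case: eqP => [-> _|_]; first by have [] := in_E x xE.
  by case: ifP => // /andP[_ li] _; rewrite (le_trans _ ix)// t_le.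
(* Free piece at the right end, zero to the left of t i. *)
- pose N l := if l == k then (2 * m).+1 else support (fun l => (i <= l < k)%N) l.
  have ltik : (i < k)%N by rewrite -(prednK hk) ltnS -subn1.
  have := @count_bound N (mem `]t i%:Z, t k%:Z]).
  rewrite big_nat_recr//= [N k]/N eqxx leq_add2r.
  have -> : (\sum_(0 <= l < k) N l = \sum_(i <= l < k) (m + mu l%:Z))%N.
    rewrite -[RHS](@sum_nat_restrict i k k)//.
    by apply: eq_big_nat => l /andP[l1 lk]; rewrite /N ltn_eqF.
  apply=> [l _|l /andP[_ lk]|x xE].
  + by rewrite /N /support; case: ifP => // _; case: ifP.
  + by rewrite /N /support ltn_eqF//; case: ifP.
  rewrite /= in_itv /= (in_E x xE).2 andbT -leNgt => xi.
  left=> l lk; rewrite /N /support; case: eqP => [-> _|_].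
    by split; [rewrite (le_trans xi)// t_le// ltnW | move=> k0; rewrite k0 in hk].
  by case: ifP => // /andP[il _] _; rewrite (le_trans xi)// t_le.
(* Zero outside ]t i, t j[. *)
- pose N := support (fun l => (i <= l < j.+1)%N).
  have := @count_bound N (mem `]t i%:Z, t j%:Z[).
  rewrite sum_nat_restrict// /num_points -addnA addn1; apply.
  + by move=> l _; rewrite /N /support; case: ifP.
  + by move=> l _; rewrite /N /support; case: ifP.
  move=> x xE; rewrite /= in_itv /= negb_and -!leNgt => /orP[xi|jx].
    left=> l lk; rewrite /N /support; case: ifP => // /andP[il lj] _.
    by rewrite (le_trans xi)// t_le.
  right=> l lk; rewrite /N /support; case: ifP => // /andP[il lj] _.
  by rewrite (le_trans _ jx)// t_le.
Qed.
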